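(* Let $d\geq 1$ and let $\mu$ and $\nu$ be two random probability measures on the cube $[0,1]^d$, defined on a common probability space, such that for some $0\leq\delta\leq2$ their characteristic functions satisfy $\mathbb{E}\big(|f_\mu(\pi m)-f_\nu(\pi m)|^2\big)\leq\delta^2$ for all $m\in\mathbb{Z}^d$. Then $$ \mathbb{E}\big(\mathrm{W}_1(\mu,\nu)\big)\ \leq\ \begin{cases} \delta & \text{if } d=1,\\ 5\,\delta\,\sqrt{1+\log\big(\frac{4}{\delta^2}\big)} & \text{if } d=2,\\ 10\,\sqrt d\,\delta^{2/d} & \text{if } d\geq3. \end{cases} $$
   Context: For a probability measure $\mu$ on $[0,1]^d$, its characteristic function is $f_\mu(\xi)=\int e^{i\langle \xi,x\rangle}\,d\mu(x)$, $\xi\in\mathbb{R}^d$; for random $\mu$ it is a random function. For Borel probability measures $\mu,\nu$ on $\mathbb{R}^d$ with finite first moment, $\mathrm{W}_1(\mu,\nu)=\inf_\lambda \int_{\mathbb{R}^d}\int_{\mathbb{R}^d}|x-y|\,d\lambda(x,y)$, where the infimum is over all probability measures $\lambda$ on $\mathbb{R}^d\times\mathbb{R}^d$ with marginals $\mu$ and $\nu$, and $|\cdot|$ is the Euclidean norm. When $d=2$ and $\delta=0$, the right-hand side is read as its limit $0$ as $\delta\to0$. *)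

(* Defs.v *)
From HB Require Import structures.
From mathcomp Require Import all_boot all_order all_algebra.
From mathcomp Require Import all_classical all_reals all_analysis.
From mathcomp Require Import complex.

Set Implicit Arguments.
Unset Strict Implicit.
Unset Printing Implicit Defensive.

Import Order.TTheory GRing.Theory Num.Theory.
Import numFieldNormedType.Exports.

Local Open Scope classical_set_scope.
Local Open Scope ring_scope.

(* R^d is d.-tuple R: its sigma-algebra is the one generated by the coordinate
   maps, i.e. the Borel sigma-algebra, R being second countable. *)

Definition inner (R : realType) (d : nat) (x y : d.-tuple R) : R :=
  \sum_(i < d) tnth x i * tnth y i.

Definition eucl_dist (R : realType) (d : nat) (x y : d.-tuple R) : R :=
  Num.sqrt (\sum_(i < d) (tnth x i - tnth y i) ^+ 2).

Definition cube (R : realType) (d : nat) : set (d.-tuple R) :=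
  [set x | forall i : 'I_d, 0 <= tnth x i <= 1].

(* exp (i t) *)
Definition expi (R : realType) (t : R) : R[i] := Complex (cos t) (sin t).

Definition complex_integral (disp : measure_display) (T : measurableType disp)
    (R : realType) (mu : {measure set T -> \bar R}) (f : T -> R[i]) : R[i] :=
  Complex (Rintegral mu setT (fun x => complex.Re (f x)))
          (Rintegral mu setT (fun x => complex.Im (f x))).

Definition char_fun (R : realType) (d : nat)
    (mu : probability (d.-tuple R) R) (xi : d.-tuple R) : R[i] :=
  complex_integral mu (fun x => expi (inner xi x)).

(* the frequency pi m in R^d, for m in Z^d *)
Definition pi_lattice (R : realType) (d : nat) (m : d.-tuple int) :
    d.-tuple R :=
  [tuple pi * (tnth m i)%:~R | i < d].

Definition couplings (R : realType) (d : nat)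
    (mu nu : probability (d.-tuple R) R) :
    set (probability (d.-tuple R * d.-tuple R)%type R) :=
  [set lambda | forall A : set (d.-tuple R), measurable A ->
    lambda (fst @^-1` A) = mu A /\ lambda (snd @^-1` A) = nu A].

Definition W1 (R : realType) (d : nat)
    (mu nu : probability (d.-tuple R) R) : \bar R :=
  ereal_inf [set (\int[lambda]_z (eucl_dist z.1 z.2)%:E)%E
            | lambda in couplings mu nu].

(* For d = 2 and delta = 0 the formula means its limit 0 as delta -> 0; here
   4 / 0 and ln 0 have default values in R, so the factor delta makes the value
   0. For d >= 3, 0 `^ (2 / d) = 0. *)
Definition W1_bound (R : realType) (d : nat) (delta : R) : R :=
  if d == 1%N then delta
  else if d == 2%N then 5 * delta * Num.sqrt (1 + ln (4 / delta ^+ 2))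
  else 10 * Num.sqrt d%:R * delta `^ (2 / d%:R).

(* Main.v *)
Require Import Defs.
From mathcomp Require Import all_boot all_order all_algebra.
From mathcomp Require Import all_classical all_reals all_analysis.
From mathcomp Require Import complex.
From mathcomp Require Import measurable_realfun ring lra zify.

Import Order.TTheory GRing.Theory Num.Theory.
Import numFieldNormedType.Exports.

Local Open Scope classical_set_scope.
Local Open Scope ring_scope.

(** The distance is estimated through its dual description. For a function [f]
    that is 1-Lipschitz on the cube, [f] is replaced by a smoothing of it, a
    trigonometric polynomial of degree at most [T] in each variable; this costs
    an error of order [sqrt d / T] for each of the two measures. The integral of
    the polynomial against [mu - nu] is a sum over the frequencies
    [0 < |m| <= T] of products of a Fourier coefficient of [f] and one of
    [mu - nu]. The arithmetic-geometric mean inequality with weights [|m| ^+ 2]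
    separates the two factors: the coefficients of [f] contribute its Dirichlet
    energy, at most [d] by Bessel's inequality, and those of [mu - nu]
    contribute, in expectation, at most [delta ^+ 2] times the sum of
    [1 / |m| ^+ 2]. This sum is bounded for [d = 1], logarithmic in [T] for
    [d = 2] and of order [T ^+ (d - 2)] for [d >= 3]; choosing [T] gives the
    three bounds.

    Since the frequencies are [pi * m], the cube is half a period in each
    variable, and even reflection reduces the analysis to the real modes
    [\prod_i cos (pi * m_i * x_i)]. Such a mode is the average, over all
    choices of signs of the [m_i], of the lattice characters, so that its
    integral against [mu - nu] inherits the bound [delta] ([mode_gap_le]).

    The dual function is produced on a finite grid. The cube is cut into
    [n ^ d] cells; the transport problem between the masses of the cells is
    finite, and [kantorovich_finite] yields a plan together with a Lipschitz
    function on the centres of the cells of almost the same value.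
    [block_coupling] turns the plan into a coupling of the two measures. The
    function on the centres is then analysed with the discrete cosine transform:
    the centres are the nodes at which the modes are orthogonal
    ([mode_orthogonal]), the gradient is replaced by finite differences
    ([energy_bessel], [energy_lipschitz]), and the smoothing kernel
    ([smoothing_kernel]) integrates exactly against sums over the nodes. All
    estimates are uniform in [n], which then tends to infinity.

    [W1_le_modes] is the resulting bound for two fixed measures,
    [expected_W1_spectral] the bound in expectation, and [box_sum_dim1],
    [box_sum_dim2], [box_sum_dim3] bound the sums over the frequencies. *)

(** * Duality for finite transport problems *)

(** First-order condition at a minimum: along a one-sided variation of size
    [t] the cost changes by [t * A + t ^+ 2 * B]. *)
Lemma quadratic_ge0_linear_ge0 {R : realType} (A B t0 : R) : 0 < t0 ->
  (forall t, 0 <= t <= t0 -> 0 <= t * A + t ^+ 2 * B) -> 0 <= A.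
Proof.
move=> t0_gt0 H; rewrite leNgt; apply/negP => A0.
pose t := Num.min t0 (- A / (2 * (`|B| + 1))).
have B1 : 0 < `|B| + 1 by rewrite ltr_wpDl.
have t_gt0 : 0 < t by rewrite lt_min t0_gt0 divr_gt0 ?oppr_gt0 // mulr_gt0.
have tt0 : t <= t0 by rewrite ge_min lexx.
have tA : t * (`|B| + 1) <= - A / 2.
  have : t <= - A / (2 * (`|B| + 1)) by rewrite ge_min lexx orbT.
  rewrite invfM mulrA ler_pdivlMr //.
have := H t; rewrite tt0 (ltW t_gt0) => /(_ isT).
have -> : t * A + t ^+ 2 * B = t * (A + t * B) by ring.
rewrite pmulr_rge0 //; have := ler_norm B.
move=> BB; have : t * B <= t * (`|B| + 1) by rewrite ler_pM2l //; lra.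
lra.
Qed.

Section FiniteTransport.
Context {R : realType} {G : finType}.
Implicit Types (p q : G -> R) (c : G -> G -> R) (a : G -> G -> R).

Definition row_mass a x : R := \sum_y a x y.
Definition col_mass a y : R := \sum_x a x y.
Definition total_cost c a : R := \sum_x \sum_y c x y * a x y.
(** The marginal constraints become quadratic penalties, so that any single
    entry of a plan can be varied freely and the optimality conditions at a
    minimum are explicit. *)
Definition penalized_cost c p q (e : R) a : R := total_cost c a
  + (2 * e)^-1 * (\sum_x (p x - row_mass a x) ^+ 2
                  + \sum_y (q y - col_mass a y) ^+ 2).

Let bump a x0 y0 (t : R) x y : R := a x y + ((x == x0) && (y == y0))%:R * t.

Lemma row_mass_bump a x0 y0 t x :
  row_mass (bump a x0 y0 t) x = row_mass a x + (x == x0)%:R * t.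
Proof.
rewrite /row_mass /bump big_split /=; congr (_ + _).
rewrite (bigD1 y0) //= eqxx andbT big1 ?addr0 // => y /negbTE ->.
by rewrite andbF mul0r.
Qed.

Lemma col_mass_bump a x0 y0 t y :
  col_mass (bump a x0 y0 t) y = col_mass a y + (y == y0)%:R * t.
Proof.
rewrite /col_mass /bump big_split /=; congr (_ + _).
rewrite (bigD1 x0) //= eqxx big1 ?addr0 // => x /negbTE ->.
by rewrite mul0r.
Qed.

Lemma sum_sqr_bump p (r : G -> R) x0 t :
  \sum_x (p x - (r x + (x == x0)%:R * t)) ^+ 2 =
  \sum_x (p x - r x) ^+ 2 - 2 * t * (p x0 - r x0) + t ^+ 2.
Proof.
rewrite (bigD1 x0) //= [in RHS](bigD1 x0) //= eqxx mul1r.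
rewrite (eq_bigr (fun x => (p x - r x) ^+ 2)) => [|x /negbTE ->]; first by ring.
by rewrite mul0r addr0.
Qed.

Lemma penalized_cost_bump c p q (e : R) a x y t : 0 < e ->
  penalized_cost c p q e (bump a x y t) = penalized_cost c p q e a
  + t * (c x y - (p x - row_mass a x) / e - (q y - col_mass a y) / e)
  + t ^+ 2 * e^-1.
Proof.
move=> e0; rewrite /penalized_cost.
under eq_bigr do rewrite row_mass_bump.
under [X in _ + _ * (_ + X)]eq_bigr do rewrite col_mass_bump.
rewrite !sum_sqr_bump.
have -> : total_cost c (bump a x y t) = total_cost c a + c x y * t.
  rewrite /total_cost /bump; under eq_bigr do under eq_bigr do rewrite mulrDr.
  under eq_bigr do rewrite big_split /=.
  rewrite big_split /=; congr (_ + _).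
  rewrite (bigD1 x) //= [X in _ + X]big1 => [|x' /negbTE xx']; last first.
    by rewrite big1 // => y' _; rewrite xx' mul0r mulr0.
  rewrite (bigD1 y) //= [X in _ + X + _]big1 => [|y' /negbTE ->]; last first.
    by rewrite andbF mul0r mulr0.
  by rewrite !eqxx mul1r !addr0.
by field; rewrite gt_eqF.
Qed.

(** A minimum exists over the compact box of plans with entries in [0, 2]. The
    bound 2 exceeds all marginals, so that an entry reaching it has negative
    potentials and is trivially dual feasible. Varying one entry shows
    that the marginal defects divided by [e] are potentials: they are dual
    feasible, and tight on the support of the plan. *)
Lemma penalized_cost_min c p q (e : R) : (forall x y, 0 <= c x y) ->
  (forall x, 0 <= p x <= 1) -> (forall x, 0 <= q x <= 1) -> 0 < e ->
  exists a, [/\ forall x y, 0 <= a x y,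
    penalized_cost c p q e a <= penalized_cost c p q e (fun x y => p x * q y),
    forall x y, (p x - row_mass a x) / e + (q y - col_mass a y) / e <= c x y &
    forall x y, 0 < a x y ->
      c x y <= (p x - row_mass a x) / e + (q y - col_mass a y) / e].
Proof.
move=> c0 p01 q01 e0.
pose n := #|{: G * G}|.
pose mat (v : 'rV[R]_n) x y := v ord0 (enum_rank (x, y)).
pose box := [set v : 'rV[R]_n | forall i, `[0, 2%R]%classic (v ord0 i)].
have cbox : compact box.
  apply: (@rV_compact R n (fun=> `[0, 2%R]%classic)) => i.
  exact: segment_compact.
have box0 : box !=set0.
  by exists 0 => i /=; rewrite mxE in_itv /= lexx ler0n.
pose F v := penalized_cost c p q e (mat v).
have cmat x y : continuous (fun v => mat v x y) by exact: coord_continuous.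
have cadd (f g : 'rV[R]_n -> R) : continuous f -> continuous g ->
    continuous (fun v => f v + g v).
  by move=> cf cg v; exact: (cvgD (cf v) (cg v)).
have cmul (f g : 'rV[R]_n -> R) : continuous f -> continuous g ->
    continuous (fun v => f v * g v).
  by move=> cf cg v; exact: (cvgM (cf v) (cg v)).
have ccst (k : R) : continuous (fun _ : 'rV[R]_n => k).
  exact: cst_continuous.
have csum (f : G -> 'rV[R]_n -> R) :
    (forall i, continuous (f i)) -> continuous (fun v => \sum_i f i v).
  move=> cf; suff H r : continuous (fun v => \sum_(i <- r) f i v) by exact: H.
  elim: r => [|i r IH].
    by under eq_fun do rewrite big_nil; exact: ccst.
  by under eq_fun do rewrite big_cons; exact: cadd.
have csqr (f : 'rV[R]_n -> R) (k : R) : continuous f ->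
    continuous (fun v => (k - f v) ^+ 2).
  move=> cf; have cB : continuous (fun v => k - f v).
    by move=> v; exact: (cvgB (ccst k v) (cf v)).
  exact: cmul.
have cF : continuous F.
  rewrite /F /penalized_cost /total_cost; apply: (cadd).
    apply: (csum) => x; apply: (csum) => y.
    by apply: cmul => //; exact: ccst.
  apply: cmul; first exact: ccst.
  by apply: cadd; apply: (csum) => x; apply: csqr; apply: (csum).
have [v] := EVT_min_rV box0 cbox (continuous_subspaceT cF).
rewrite inE => bv vmin; exists (mat v).
have mat_surj a : (forall x y, 0 <= a x y <= 2) ->
    F v <= penalized_cost c p q e a.
  move=> a01; pose w : 'rV[R]_n := \row_i a (enum_val i).1 (enum_val i).2.
  have -> : a = mat w.
    by apply/funext => x; apply/funext => y; rewrite /mat mxE enum_rankK.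
  by apply: vmin; rewrite inE => i /=; rewrite in_itv /= mxE a01.
have mat_box x y : 0 <= mat v x y <= 2.
  by have := bv (enum_rank (x, y)); rewrite /= in_itv.
have var x y t : 0 <= mat v x y + t <= 2 ->
    0 <= t * (c x y - (p x - row_mass (mat v) x) / e
              - (q y - col_mass (mat v) y) / e) + t ^+ 2 * e^-1.
  move=> ht; have := mat_surj (bump (mat v) x y t).
  rewrite penalized_cost_bump // -addrA lerDl; apply => x' y'; rewrite /bump.
  have [/andP[/eqP -> /eqP ->]|] := boolP ((x' == x) && (y' == y)).
    by rewrite mul1r.
  by rewrite mul0r addr0.
split.
- by move=> x y; case/andP: (mat_box x y).
- apply: mat_surj => x y; have /andP[p0 p1] := p01 x; have /andP[q0 q1] := q01 y.
  rewrite mulr_ge0 //= (@le_trans _ _ 1) ?ler1n //.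
  by rewrite -[1]mulr1 ler_pM.
- move=> x y; have /andP[m0] := mat_box x y.
  rewrite le_eqVlt => /predU1P[m2|m2].
    (* at the upper end of the box both penalty terms are negative *)
    apply: (le_trans _ (c0 x y)); rewrite -mulrDl pmulr_lle0 ?invr_gt0 //.
    have rx : 2 <= row_mass (mat v) x.
      rewrite /row_mass (bigD1 y) //= m2 lerDl sumr_ge0 // => i _.
      by case/andP: (mat_box x i).
    have ry : 2 <= col_mass (mat v) y.
      rewrite /col_mass (bigD1 x) //= m2 lerDl sumr_ge0 // => i _.
      by case/andP: (mat_box i y).
    by have /andP[_ ?] := p01 x; have /andP[_ ?] := q01 y; lra.
  rewrite -subr_ge0 opprD addrA.
  apply: (@quadratic_ge0_linear_ge0 _ _ e^-1 (2 - mat v x y)).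
    by rewrite subr_gt0.
  by move=> t /andP[t0 t1]; apply: var; lra.
- move=> x y m0; rewrite -subr_ge0.
  apply: (@quadratic_ge0_linear_ge0 _ _ e^-1 (mat v x y)) => //.
  move=> t /andP[t0 t1].
  have /andP[_ m2] := mat_box x y.
  have : 0 <= mat v x y - t <= 2 by lra.
  by move=> /var; rewrite sqrrN; lra.
Qed.

(** Lowering overfull rows and columns leaves deficits on both sides with the
    same total mass [D]; spreading them as a product costs at most [M * D]. *)
Lemma coupling_of_approximate c p q a (M : R) :
  (forall x y, 0 <= c x y <= M) -> (forall x, 0 <= p x) -> (forall x, 0 <= q x) ->
  \sum_x p x = 1 -> \sum_x q x = 1 -> (forall x y, 0 <= a x y) ->
  exists b, [/\ forall x y, 0 <= b x y, forall x, row_mass b x = p x,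
    forall y, col_mass b y = q y &
    total_cost c b <= total_cost c a + M * (\sum_x `|p x - row_mass a x|
                                            + \sum_y `|q y - col_mass a y|)].
Proof.
move=> c0M p0 q0 p1 q1 a0.
pose r := row_mass a; pose s := col_mass a.
have r0 x : 0 <= r x by apply: sumr_ge0.
have s0 x : 0 <= s x by apply: sumr_ge0.
pose shrink (u v : R) : R := if v <= u then 1 else u / v.
have shrink_ge0 u v : 0 <= u -> 0 <= shrink u v.
  move=> u0; rewrite /shrink; case: (leP v u) => // uv.
  by rewrite divr_ge0 // (le_trans u0 (ltW uv)).
have shrink_le1 u v : 0 <= u -> shrink u v <= 1.
  move=> u0; rewrite /shrink; case: (leP v u) => // uv.
  by rewrite ler_pdivrMr ?mul1r ?ltW // (le_lt_trans u0 uv).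
have shrink_mul u v : 0 <= u -> 0 <= v -> shrink u v * v <= u.
  move=> u0 v0; rewrite /shrink; case: (leP v u) => uv; first by rewrite mul1r.
  by rewrite divfK // gt_eqF // (le_lt_trans u0 uv).
have shrink_loss u v : 0 <= u -> (1 - shrink u v) * v <= (`|u - v| - (u - v)) / 2.
  move=> u0; rewrite /shrink; case: (leP v u) => uv.
    by rewrite subrr mul0r ger0_norm ?subr_ge0 // subrr mul0r.
  have v0 : v != 0 by rewrite gt_eqF // (le_lt_trans u0 uv).
  by rewrite mulrBl mul1r divfK // ltr0_norm ?subr_lt0 //; lra.
pose w x y := shrink (p x) (r x) * shrink (q y) (s y) * a x y.
have w0 x y : 0 <= w x y by rewrite !mulr_ge0 ?shrink_ge0.
have wr x : row_mass w x <= p x.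
  apply: le_trans (shrink_mul (p x) (r x) (p0 x) (r0 x)).
  rewrite /row_mass mulr_sumr; apply: ler_sum => y _.
  by rewrite ler_wpM2r // ler_piMr ?shrink_ge0 ?shrink_le1.
have wc y : col_mass w y <= q y.
  apply: le_trans (shrink_mul (q y) (s y) (q0 y) (s0 y)).
  rewrite /col_mass mulr_sumr; apply: ler_sum => x _.
  by rewrite ler_wpM2r // ler_piMl ?shrink_ge0 ?shrink_le1.
have wa x y : w x y <= a x y.
  by rewrite ler_piMl // mulr_ile1 ?shrink_ge0 ?shrink_le1.
pose p' x := p x - row_mass w x; pose q' y := q y - col_mass w y.
have p'0 x : 0 <= p' x by rewrite subr_ge0.
have q'0 x : 0 <= q' x by rewrite subr_ge0.
pose D := 1 - \sum_x row_mass w x.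
have Dp : \sum_x p' x = D by rewrite sumrB p1.
have Dq : \sum_x q' x = D.
  by rewrite sumrB q1 /D /row_mass exchange_big.
have D0 : 0 <= D by rewrite -Dp sumr_ge0.
have Dle : D <= \sum_x `|p x - r x| + \sum_y `|q y - s y|.
  have H1 : \sum_x row_mass a x - \sum_x row_mass w x <=
      \sum_x (1 - shrink (p x) (r x)) * r x
      + \sum_y (1 - shrink (q y) (s y)) * s y.
    have -> : \sum_y (1 - shrink (q y) (s y)) * s y =
        \sum_x \sum_y (1 - shrink (q y) (s y)) * a x y.
      by rewrite exchange_big; apply: eq_bigr => y _; rewrite mulr_sumr.
    rewrite -sumrB -big_split /=; apply: ler_sum => x _.
    rewrite /r /row_mass -sumrB mulr_sumr -big_split /=; apply: ler_sum => y _.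
    rewrite /w -/(r x).
    have A := shrink_ge0 _ (r x) (p0 x); have A' := shrink_le1 _ (r x) (p0 x).
    have B := shrink_ge0 _ (s y) (q0 y); have B' := shrink_le1 _ (s y) (q0 y).
    rewrite -[X in X - _]mul1r -mulrBl -mulrDl ler_wpM2r //.
    rewrite -subr_ge0.
    have -> : 1 - shrink (p x) (r x) + (1 - shrink (q y) (s y)) -
      (1 - shrink (p x) (r x) * shrink (q y) (s y)) =
      (1 - shrink (p x) (r x)) * (1 - shrink (q y) (s y)) by ring.
    by rewrite mulr_ge0 ?subr_ge0.
  have H2 : \sum_x (1 - shrink (p x) (r x)) * r x <=
      (\sum_x `|p x - r x| - \sum_x (p x - r x)) / 2.
    rewrite -sumrB mulr_suml; apply: ler_sum => x _; exact: shrink_loss.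
  have H3 : \sum_x (1 - shrink (q x) (s x)) * s x <=
      (\sum_x `|q x - s x| - \sum_x (q x - s x)) / 2.
    rewrite -sumrB mulr_suml; apply: ler_sum => x _; exact: shrink_loss.
  have H4 : 0 <= \sum_x `|p x - r x| by exact: sumr_ge0.
  have H5 : 0 <= \sum_x `|q x - s x| by exact: sumr_ge0.
  have E1 : \sum_x (p x - r x) = 1 - \sum_x row_mass a x by rewrite sumrB p1.
  have E2 : \sum_x (q x - s x) = 1 - \sum_x row_mass a x.
    by rewrite sumrB q1 /row_mass exchange_big.
  rewrite E1 in H2; rewrite E2 in H3; rewrite /D; lra.
pose b x y := w x y + p' x * q' y / D.
have bD0 : D = 0 -> (forall x, p' x = 0) /\ (forall x, q' x = 0).
  move=> DE; split=> x; apply/eqP.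
    have : \sum_x p' x == 0 by rewrite Dp DE.
    by rewrite psumr_eq0 // => /allP/(_ x (mem_index_enum _)).
  have : \sum_x q' x == 0 by rewrite Dq DE.
  by rewrite psumr_eq0 // => /allP/(_ x (mem_index_enum _)).
have row_b x : row_mass b x = p x.
  rewrite /row_mass big_split /= -mulr_suml -mulr_sumr Dq.
  have [/bD0[p'E _]|DN] := eqVneq D 0.
    rewrite p'E !mul0r addr0; apply/esym/eqP.
    by rewrite -subr_eq0; apply/eqP/p'E.
  by rewrite mulfK // /p' subrKC.
have col_b y : col_mass b y = q y.
  rewrite /col_mass big_split /= -mulr_suml -mulr_suml Dp.
  have [/bD0[_ q'E]|DN] := eqVneq D 0.
    rewrite q'E !(mul0r, mulr0) addr0; apply/esym/eqP.
    by rewrite -subr_eq0; apply/eqP/q'E.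
  by rewrite [D * _]mulrC mulfK // /q' subrKC.
exists b; split=> //.
  by move=> x y; rewrite addr_ge0 // divr_ge0 // mulr_ge0.
have [G0|/card_gt0P[x0 _]] := posnP #|G|.
  move: p1; rewrite big1 ?(eqP _) // => [/esym/eqP|x _].
    by rewrite oner_eq0.
  by have := fintype0 x G0.
have M0 : 0 <= M by have /andP[] := c0M x0 x0; exact: le_trans.
have -> : total_cost c b =
    total_cost c w + \sum_x \sum_y c x y * (p' x * q' y / D).
  rewrite /total_cost -big_split; apply: eq_bigr => x _ /=.
  by rewrite -big_split; apply: eq_bigr => y _ /=; rewrite mulrDr.
apply: lerD.
  apply: ler_sum => x _; apply: ler_sum => y _; rewrite ler_wpM2l //.
  by case/andP: (c0M x y).
apply: le_trans (ler_wpM2l M0 Dle).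
have [/bD0[p'E _]|DN] := eqVneq D 0.
  rewrite big1 ?mulr_ge0 // => x _; rewrite big1 // => y _.
  by rewrite p'E !mul0r mulr0.
have {2}-> : D = \sum_x \sum_y p' x * q' y / D.
  under eq_bigr do rewrite -mulr_suml -mulr_sumr Dq mulfK //.
  by rewrite Dp.
rewrite mulr_sumr; apply: ler_sum => x _; rewrite mulr_sumr.
apply: ler_sum => y _; rewrite ler_wpM2r ?divr_ge0 ?mulr_ge0 //.
by case/andP: (c0M x y).
Qed.

(** Duality up to [k]. For a small penalty parameter [e] the minimal plan of
    the penalized problem is nearly a coupling, and its cost is at most the
    value of its own potentials, by complementary slackness; their c-transform
    is Lipschitz. *)
Lemma kantorovich_finite c p q (M k : R) :
  (forall x y, 0 <= c x y <= M) -> (forall x, c x x = 0) ->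
  (forall x y z, c x z <= c x y + c y z) ->
  (forall x, 0 <= p x) -> (forall x, 0 <= q x) ->
  \sum_x p x = 1 -> \sum_x q x = 1 -> 0 < k ->
  exists b f, [/\ forall x y, 0 <= b x y, forall x, row_mass b x = p x,
    forall y, col_mass b y = q y, forall x y, f x - f y <= c x y &
    total_cost c b <= \sum_x f x * (p x - q x) + k].
Proof.
move=> c0M cxx ctri p0 q0 p1 q1 k0.
have [G0|/card_gt0P[x0 _]] := posnP #|G|.
  move: p1; rewrite big1 ?(eqP _) // => [/esym/eqP|x _].
    by rewrite oner_eq0.
  by have := fintype0 x G0.
have M0 : 0 <= M by have /andP[] := c0M x0 x0; exact: le_trans.
have le1 (u : G -> R) : (forall x, 0 <= u x) -> \sum_x u x = 1 ->
    forall x, 0 <= u x <= 1.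
  move=> u0 u1 x; rewrite u0 /= -u1 (bigD1 x) //= lerDl sumr_ge0 //.
(* each marginal error is at most sqrt (2 e M) *)
pose N : R := #|G|%:R.
pose eta := k / (M * (N + N) + 1).
have NN : 0 <= M * (N + N) by rewrite mulr_ge0 // addr_ge0 // ler0n.
have eta0 : 0 < eta by rewrite divr_gt0 // ltr_wpDl.
pose e := eta ^+ 2 / (2 * (M + 1)).
have M1 : 0 < 2 * (M + 1) by rewrite mulr_gt0 // ltr_wpDl.
have e0 : 0 < e by rewrite divr_gt0 // exprn_gt0.
have c0 x y : 0 <= c x y by case/andP: (c0M x y).
have [a [a0 amin aff comp]] :=
  penalized_cost_min c p q e c0 (le1 p p0 p1) (le1 q q0 q1) e0.
set phi := fun x => (p x - row_mass a x) / e in aff comp.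
set psi := fun y => (q y - col_mass a y) / e in aff comp.
have pqM : penalized_cost c p q e (fun x y => p x * q y) <= M.
  rewrite /penalized_cost.
  rewrite big1 => [|x _]; last first.
    by rewrite /row_mass -mulr_sumr q1 mulr1 subrr expr0n.
  rewrite big1 => [|x _]; last first.
    by rewrite /col_mass -mulr_suml p1 mul1r subrr expr0n.
  rewrite !addr0 mulr0 addr0 /total_cost.
  have -> : M = \sum_x \sum_y M * (p x * q y).
    under eq_bigr do rewrite -mulr_sumr -mulr_sumr q1 mulr1.
    by rewrite -mulr_sumr p1 mulr1.
  apply: ler_sum => x _; apply: ler_sum => y _.
  by rewrite ler_wpM2r ?mulr_ge0 //; case/andP: (c0M x y).
have cost_a0 : 0 <= total_cost c a.
  by apply: sumr_ge0 => x _; apply: sumr_ge0 => y _; rewrite mulr_ge0.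
have sqP : 0 <= \sum_x (p x - row_mass a x) ^+ 2.
  by apply: sumr_ge0 => x _; exact: sqr_ge0.
have sqQ : 0 <= \sum_x (q x - col_mass a x) ^+ 2.
  by apply: sumr_ge0 => x _; exact: sqr_ge0.
have pen : \sum_x (p x - row_mass a x) ^+ 2
           + \sum_y (q y - col_mass a y) ^+ 2 <= eta ^+ 2.
  have : (2 * e)^-1 * (\sum_x (p x - row_mass a x) ^+ 2
           + \sum_y (q y - col_mass a y) ^+ 2) <= M.
    by apply: le_trans (le_trans amin pqM); rewrite lerDr.
  have e2 : 0 < 2 * e by exact: (mulr_gt0 (ltr0Sn R 1) e0).
  rewrite mulrC ler_pdivrMr // => /le_trans; apply.
  rewrite /e (_ : M * _ = eta ^+ 2 * (M / (M + 1))); last first.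
    by field; lra.
  rewrite ler_piMr ?sqr_ge0 // ler_pdivrMr ?mul1r; lra.
have errp x : `|p x - row_mass a x| <= eta.
  rewrite -ler_sqr ?nnegrE ?(ltW eta0) // real_normK ?num_real //.
  apply: le_trans pen.
  apply: (@le_trans _ _ (\sum_x (p x - row_mass a x) ^+ 2)); last by rewrite lerDl.
  by rewrite (bigD1 x) //= lerDl sumr_ge0 // => i _; exact: sqr_ge0.
have errq x : `|q x - col_mass a x| <= eta.
  rewrite -ler_sqr ?nnegrE ?(ltW eta0) // real_normK ?num_real //.
  apply: le_trans pen.
  apply: (@le_trans _ _ (\sum_x (q x - col_mass a x) ^+ 2)); last by rewrite lerDr.
  by rewrite (bigD1 x) //= lerDl sumr_ge0 // => i _; exact: sqr_ge0.
have [b [b0 bp bq bc]] := coupling_of_approximate c p q a M c0M p0 q0 p1 q1 a0.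
(* the c-transform turns the two potentials into a single Lipschitz one *)
pose g x y := c x y - psi y.
pose f x := g x [arg min_(y < x0) g x y]%O.
have fmin x y : f x <= g x y.
  by rewrite /f; case: arg_minP => // i _; apply.
have fphi x : phi x <= f x.
  by rewrite /f {1}/g lerBrDr; exact: aff.
have fpsi x : f x <= - psi x by have := fmin x x; rewrite /g cxx sub0r.
exists b, f; split => //.
  move=> x y; rewrite lerBlDr {2}/f; set z := [arg min_(_ < _) _]%O.
  apply: (le_trans (fmin x z)); rewrite /g addrA lerD2r; exact: ctri.
apply: (le_trans bc).
have H1 : total_cost c a <= \sum_x phi x * p x + \sum_y psi y * q y.
  apply: (@le_trans _ _ (\sum_x phi x * row_mass a x + \sum_y psi y * col_mass a y)).
    have -> : \sum_y psi y * col_mass a y = \sum_x \sum_y psi y * a x y.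
      by rewrite exchange_big; apply: eq_bigr => y _; rewrite mulr_sumr.
    rewrite -big_split; apply: ler_sum => x _ /=.
    rewrite mulr_sumr -big_split; apply: ler_sum => y _ /=.
    rewrite -mulrDl; have := a0 x y; rewrite le_eqVlt => /predU1P[<-|axy].
      by rewrite !mulr0.
    by rewrite ler_pM2r //; exact: comp.
  have sq (u v : R) : (u - v) / e * v <= (u - v) / e * u.
    by rewrite -subr_ge0 -mulrBr mulrAC -expr2 divr_ge0 ?sqr_ge0 ?ltW.
  by apply: lerD; apply: ler_sum => x _; exact: sq.
have H2 : \sum_x phi x * p x + \sum_y psi y * q y <= \sum_x f x * (p x - q x).
  rewrite -big_split; apply: ler_sum => x _ /=; rewrite mulrBr lerD //.
    by rewrite ler_wpM2r.
  by rewrite -mulNr ler_wpM2r // lerNr fpsi.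
apply: lerD; first exact: le_trans H1 H2.
apply: (@le_trans _ _ (M * (N * eta + N * eta))).
  have -> : N * eta = \sum_(x : G) eta by rewrite sumr_const mulr_natl.
  by rewrite ler_wpM2l // lerD //; apply: ler_sum => x _.
rewrite -mulrDl mulrA /eta mulrA ler_pdivrMr ?ltr_wpDl //.
by rewrite mulrC ler_pM2l // lerDl.
Qed.

End FiniteTransport.

(** * Trigonometric inequalities and cosine sums *)

Section Trigonometry.
Context {R : realType}.
Implicit Types (s t x y : R).

(** Concavity of sine on [0, pi], from the mean value theorem on both sides of
    [s * a]. *)
Lemma sin_concave s (a : R) : 0 <= s <= 1 -> 0 <= a <= pi ->
  s * sin a <= sin (s * a).
Proof.
move=> /andP[]; rewrite le_eqVlt => /predU1P[<- _ _|s0].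
  by rewrite !mul0r sin0.
rewrite le_eqVlt => /predU1P[-> _|s1]; first by rewrite !mul1r.
move=> /andP[]; rewrite le_eqVlt => /predU1P[<- _|a0 api].
  by rewrite !mulr0 sin0 mulr0.
have sa0 : 0 < s * a by rewrite mulr_gt0.
have saa : s * a < a by rewrite gtr_pMl.
have dsin (z : R) : is_derive z 1 (@sin R) (cos z) by exact: is_derive_sin.
have csin (u v : R) : {within `[u, v], continuous (@sin R)}.
  by apply: continuous_subspaceT; exact: continuous_sin.
have [c1] := MVT sa0 (fun z _ => dsin z) (csin _ _).
have [c2] := MVT saa (fun z _ => dsin z) (csin _ _).
rewrite !in_itv /= sin0 !subr0 => /andP[c2l c2r] E2 /andP[c1l c1r] E1.
have c12 : c1 < c2 by exact: lt_trans c1r c2l.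
have : cos c2 <= cos c1.
  apply/ltW; rewrite ltr_cos // in_itv /=.
    by rewrite (ltW c1l) (le_trans (ltW c12)) // (le_trans (ltW c2r)).
  by rewrite (ltW (lt_trans c1l c12)) (le_trans (ltW c2r)).
move=> cc.
have H : sin a - sin (s * a) <= cos c1 * (a - s * a).
  by rewrite E2 ler_pM2r // subr_gt0.
have H1 : s * (sin a - sin (s * a)) <= s * (cos c1 * (a - s * a)).
  by rewrite ler_pM2l.
have H2 : s * (cos c1 * (a - s * a)) = (1 - s) * sin (s * a).
  by rewrite E1; ring.
lra.
Qed.

Lemma one_sub_cos t : 1 - cos (pi * t) = 2 * sin (pi * t / 2) ^+ 2.
Proof.
have {1}-> : pi * t = (pi * t / 2) *+ 2 by rewrite -mulr_natr divfK.
by rewrite cos_mulr2n -[in LHS]mulr_natl cos2sin2 -mulr_natl; ring.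
Qed.

Lemma one_sub_cos_ge2 t : `|t| <= 1 -> 2 * t ^+ 2 <= 1 - cos (pi * t).
Proof.
move=> t1; rewrite -real_normK ?num_real //.
have -> : cos (pi * t) = cos (pi * `|t|).
  by rewrite -cos_norm normrM (ger0_norm (pi_ge0 R)).
rewrite one_sub_cos ler_pM2l // ler_pXn2r ?nnegrE ?normr_ge0 //; last first.
  apply: sin_ge0_pi; rewrite divr_ge0 ?mulr_ge0 ?pi_ge0 //=.
  by have := ler_wpM2l (pi_ge0 R) t1; have := pi_ge0 R; lra.
have := @sin_concave `|t| (pi / 2); rewrite sin_pihalf mulr1.
rewrite (_ : `|t| * (pi / 2) = pi * `|t| / 2); last by ring.
by apply; rewrite ?normr_ge0 //; have := pi_ge0 R; lra.
Qed.

Lemma one_sub_cos_ge4 t : 0 <= t <= 2^-1 -> 4 * t ^+ 2 <= 1 - cos (pi * t).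
Proof.
move=> /andP[t0 t1].
have p0 := pi_ge0 R.
have := @sin_concave (2 * t) (pi / 4).
have -> : 2 * t * (pi / 4) = pi * t / 2 by field.
move=> H; have {H} : 2 * t * sin (pi / 4) <= sin (pi * t / 2) by apply: H; lra.
have sp0 : 0 <= sin (pi / 4 : R) by apply: sin_ge0_pi; lra.
have sp : 2 * sin (pi / 4 : R) ^+ 2 = 1.
  have := one_sub_cos 2^-1; rewrite cos_pihalf subr0 => E.
  by rewrite [RHS]E (_ : pi / 2 / 2 = pi / 4 :> R) //; field.
move=> H; rewrite one_sub_cos.
have : (2 * t * sin (pi / 4)) ^+ 2 <= sin (pi * t / 2) ^+ 2.
  have H0 : 0 <= 2 * t * sin (pi / 4) by rewrite !mulr_ge0.
  by rewrite ler_pXn2r // nnegrE // (le_trans H0).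
by rewrite exprMn; nra.
Qed.

(** For points of [0, 1] the distance is controlled by the chord on the circle
    of length 2. *)
Lemma sqr_dist_le_cosB x y : 0 <= x <= 1 -> 0 <= y <= 1 ->
  (x - y) ^+ 2 <= 2^-1 * (1 - cos (pi * (x - y))).
Proof.
move=> x01 y01; have := @one_sub_cos_ge2 (x - y).
by rewrite ler_norml => H; have {H} := H ltac:(lra); lra.
Qed.

(** The same with [y] reflected about 0: since both sines are nonnegative,
    [cos (pi * (x + y)) <= cos (pi * (x - y))]. *)
Lemma sqr_dist_le_cosD x y : 0 <= x <= 1 -> 0 <= y <= 1 ->
  (x - y) ^+ 2 <= 2^-1 * (1 - cos (pi * (x + y))).
Proof.
move=> x01 y01; apply: le_trans (sqr_dist_le_cosB _ _ x01 y01) _.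
have p0 := pi_ge0 R.
have s0 z : 0 <= z <= 1 -> 0 <= sin (pi * z : R).
  by move=> /andP[z0 z1]; apply: sin_ge0_pi; rewrite mulr_ge0 //= ler_piMr.
rewrite [pi * (x - y)]mulrBr [pi * (x + y)]mulrDr cosB cosD.
by have := mulr_ge0 (s0 _ x01) (s0 _ y01); lra.
Qed.

Lemma cos_mulz_pi (k : int) : cos (pi * k%:~R : R) = (-1) ^+ `|k|%N.
Proof.
have nat_case (m : nat) : cos (pi * m%:R : R) = (-1) ^+ m.
  elim: m => [|m IH]; first by rewrite mulr0 cos0.
  by rewrite -natr1 mulrDr mulr1 cosD cospi sinpi IH exprS; ring.
have : cos (pi * k%:~R : R) = cos (pi * `|k|%N%:R).
  rewrite -[in LHS]cos_norm normrM (ger0_norm (pi_ge0 R)).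
  by rewrite natr_absz intr_norm.
by move=> ->.
Qed.

Lemma sin_mulz_pi (k : int) : sin (pi * k%:~R : R) = 0.
Proof.
apply/eqP; rewrite -norm_cos_eq1 cos_mulz_pi normrX normrN1 expr1n //.
Qed.

End Trigonometry.

Section Nodes.
Context {R : realType} (n : nat).
Hypothesis n_gt0 : (0 < n)%N.

(** At the midpoints of the subintervals, unlike at their endpoints, distinct
    cosine modes are orthogonal with equal weights, which is the orthogonality
    of the discrete cosine transform. *)
Definition node (k : nat) : R := (k%:R + 2^-1) / n%:R.

Let nR : (n%:R : R) != 0. Proof. by rewrite pnatr_eq0 -lt0n. Qed.
Let nR0 : 0 < (n%:R : R). Proof. by rewrite ltr0n. Qed.

Lemma node01 (k : nat) : (k < n)%N -> 0 <= node k <= 1.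
Proof.
move=> kn; rewrite divr_ge0 ?ler0n ?addr_ge0 ?invr_ge0 ?ler0n //=.
rewrite ler_pdivrMr // mul1r; have : k.+1%:R <= n%:R :> R by rewrite ler_nat.
by rewrite -natr1; lra.
Qed.

(** The cosine sum over the midpoints telescopes after multiplication by
    [2 * sin (pi * r / (2 * n))]. *)
Lemma sum_cos_node (r : int) : (`|r| < n + n)%N ->
  \sum_(k < n) cos (pi * r%:~R * node k) = n%:R * (r == 0)%:R :> R.
Proof.
have [-> _|r0 rn] := eqVneq r 0.
  under eq_bigr do rewrite mulr0 mul0r cos0.
  by rewrite sumr_const card_ord mulr1.
rewrite mulr0; pose s : R := sin (pi * r%:~R / (2 * n%:R)).
have n2 : (2 * n%:R : R) != 0 by rewrite mulf_neq0.
have s0 : s != 0.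
  suff : sin (pi * `|r|%N%:R / (2 * n%:R) : R) != 0.
    apply: contra_neq => s0; rewrite natr_absz.
    have [rp|rm] := leP 0 r; first by rewrite ger0_norm.
    by rewrite ltr0_norm // intrN mulrN mulNr sinN [X in - X]s0 oppr0.
  rewrite gt_eqF //; apply: sin_gt0_pi.
  have p0 := pi_gt0 R.
  rewrite divr_gt0 ?mulr_gt0 ?ltr0n ?absz_gt0 //=.
  rewrite ltr_pdivrMr ?mulr_gt0 // ltr_pM2l //.
  by rewrite -natrM mul2n -addnn ltr_nat.
have s2 : 2 * s != 0 by rewrite mulf_neq0 // pnatr_eq0.
apply: (mulfI s2).
rewrite mulr0 mulr_sumr.
pose F (k : nat) : R := sin (pi * r%:~R * k%:R / n%:R).
rewrite (eq_bigr (fun k : 'I_n => F k.+1 - F k)) => [|k _].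
  rewrite -(big_mkord xpredT (fun k => F k.+1 - F k)) telescope_sumr //.
  by rewrite /F mulfK // sin_mulz_pi mulr0 mul0r sin0 subrr.
rewrite /F /s.
have -> : pi * r%:~R * k.+1%:R / n%:R =
    pi * r%:~R * node k + pi * r%:~R / (2 * n%:R) :> R.
  by rewrite /node -natr1; field.
have -> : pi * r%:~R * k%:R / n%:R =
    pi * r%:~R * node k - pi * r%:~R / (2 * n%:R) :> R.
  by rewrite /node; field.
by rewrite sinD sinB; ring.
Qed.

(** The average of [x - y] and [x + y] is convolution on [0, 1] with even
    reflection at both ends. *)
Lemma sum_cos_node_conv (r : int) x : (`|r| < n + n)%N ->
  \sum_(k < n) 2^-1 * (cos (pi * r%:~R * (x - node k))
                       + cos (pi * r%:~R * (x + node k))) =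
  n%:R * (r == 0)%:R :> R.
Proof.
move=> rn; transitivity (cos (pi * r%:~R * x) *
    \sum_(k < n) cos (pi * r%:~R * node k)).
  rewrite mulr_sumr; apply: eq_bigr => k _.
  by rewrite [_ * (x - _)]mulrBr [_ * (x + _)]mulrDr cosB cosD; field.
rewrite sum_cos_node //; have [->|_] := eqVneq r 0; last by rewrite !mulr0.
by rewrite mulr0 mul0r cos0 mul1r.
Qed.

(** The number of integers of absolute value [k]. *)
Definition freq_weight (k : nat) : R := if k == 0 then 1 else 2.

Lemma sum_cos_cos_node (k l : nat) : (k < n)%N -> (l < n)%N ->
  \sum_(y < n) cos (pi * k%:R * node y) * cos (pi * l%:R * node y) =
  n%:R * (k == l)%:R / freq_weight k.
Proof.
move=> kn ln.
have -> : \sum_(y < n) cos (pi * k%:R * node y) * cos (pi * l%:R * node y) =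
  2^-1 * (\sum_(y < n) cos (pi * (k%:Z - l%:Z)%:~R * node y) +
          \sum_(y < n) cos (pi * (k%:Z + l%:Z)%:~R * node y)).
  rewrite -big_split /= mulr_sumr; apply: eq_bigr => y _.
  rewrite intrB intrD -!pmulrn.
  have -> : pi * (k%:R - l%:R) * node y =
    pi * k%:R * node y - pi * l%:R * node y by ring.
  have -> : pi * (k%:R + l%:R) * node y =
    pi * k%:R * node y + pi * l%:R * node y by ring.
  rewrite cosB cosD.
  by field.
rewrite !sum_cos_node; [|lia..].
rewrite /freq_weight subr_eq0 eqz_nat.
have [<-{l ln}|kl] := eqVneq k l.
  have [->|k0] := eqVneq k 0; first by rewrite addr0 eqxx /= !mulr1n; field.
  by rewrite (_ : (k%:Z + k%:Z == 0) = false) ?mulr1n ?mulr0n; [field|lia].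
rewrite (_ : (k%:Z + l%:Z == 0) = false); last by lia.
by rewrite !(mulr0, mul0r, addr0).
Qed.

(** The eigenvalue of the discrete Neumann Laplacian on the [k]-th cosine
    mode. *)
Definition laplace_eigen (k : nat) : R := 2 * (1 - cos (pi * k%:R / n%:R)).

Lemma laplace_eigen_ge (k : nat) : (k + k <= n)%N ->
  8 * k%:R ^+ 2 <= n%:R ^+ 2 * laplace_eigen k.
Proof.
move=> kn; have := @one_sub_cos_ge4 R (k%:R / n%:R).
have kn2 : 0 <= (k%:R / n%:R : R) <= 2^-1.
  apply/andP; split; first by rewrite divr_ge0.
  rewrite ler_pdivrMr // mulrC ler_pdivlMr // -natrM ler_nat; lia.
move=> /(_ kn2) H; have := ler_wpM2l (ltW (exprn_gt0 2 nR0)) H.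
have -> : n%:R ^+ 2 * (4 * (k%:R / n%:R) ^+ 2) = 4 * k%:R ^+ 2 :> R by field.
by rewrite /laplace_eigen -[pi * _ / _]mulrA; lra.
Qed.

Lemma laplace_eigen_ge0 (k : nat) : 0 <= laplace_eigen k.
Proof. by rewrite /laplace_eigen; have := cos_le1 (pi * k%:R / n%:R : R); lra. Qed.

(** Cosine modes are even about 0 and about 1, so that the difference over a
    step that leaves the grid at either end is 0; at the first node this turns
    [cos_diff_succ] into [cos_diff_first]. *)
Definition cos_diff (k y : nat) : R :=
  cos (pi * k%:R * node y.+1) - cos (pi * k%:R * node y).

Lemma cos_diff_last (k : nat) : cos_diff k n.-1 = 0.
Proof.
rewrite /cos_diff prednK //.
have -> : pi * k%:R * node n = pi * k%:~R + pi * k%:R / (2 * n%:R) :> R.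
  by rewrite /node -pmulrn; field.
have -> : pi * k%:R * node n.-1 = pi * k%:~R - pi * k%:R / (2 * n%:R) :> R.
  by rewrite /node -pmulrn -subn1 natrB //; field.
by rewrite cosB cosD sin_mulz_pi; ring.
Qed.

Lemma cos_diff_succ (k y : nat) :
  cos_diff k y - cos_diff k y.+1 =
  laplace_eigen k * cos (pi * k%:R * node y.+1).
Proof.
rewrite /cos_diff /laplace_eigen.
have -> : pi * k%:R * node y.+2 = pi * k%:R * node y.+1 + pi * k%:R / n%:R :> R.
  by rewrite /node -!natr1; field.
have -> : pi * k%:R * node y = pi * k%:R * node y.+1 - pi * k%:R / n%:R :> R.
  by rewrite /node -!natr1; field.
by rewrite cosB cosD; ring.
Qed.

Lemma cos_diff_first (k : nat) :
  - cos_diff k 0 = laplace_eigen k * cos (pi * k%:R * node 0).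
Proof.
rewrite /cos_diff /laplace_eigen.
have -> : pi * k%:R * node 1 = pi * k%:R * node 0 + pi * k%:R / n%:R :> R.
  by rewrite /node; field.
have E : pi * k%:R / n%:R = pi * k%:R * node 0 + pi * k%:R * node 0 :> R.
  by rewrite /node; field.
rewrite cosD E cosD sinD; set A := pi * k%:R * node 0.
apply/eqP; rewrite -subr_eq0.
have -> : forall c s : R, - (c * (c * c - s * s) - s * (s * c + c * s) - c)
    - 2 * (1 - (c * c - s * s)) * c = c * (c ^+ 2 + s ^+ 2 - 1) by move=> *; ring.
by rewrite cos2Dsin2 subrr mulr0.
Qed.

End Nodes.

(** * A positive smoothing kernel on the unit interval *)

Section Parabola.
Context {R : realType} (T : nat).

(** A kernel whose Fourier coefficients are the autocorrelation of a sequence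
    supported on [0 .. T] is a squared modulus, hence nonnegative. Its second
    moment is governed by the squared increments of the sequence, including the
    two boundary ones; a parabola vanishing at -1 and [T + 1] is almost optimal
    (a half-period of a sine would be optimal), and all its sums are rational.
    *)
Definition parabola (k : nat) : R := k.+1%:R * (T%:R + 1 - k%:R).

Definition parabola_mass : R := \sum_(k < T.+1) parabola k ^+ 2.

(** The coefficients of frequency [m] and [- m] are added up. *)
Definition kernel_coef (m : nat) : R :=
  (\sum_(k < T.+1) \sum_(l < T.+1 | `|k%:Z - l%:Z|%N == m)
     parabola k * parabola l) / parabola_mass.

Lemma parabola_gt0 (k : 'I_T.+1) : 0 < parabola k.
Proof.
have : (k%:R : R) <= T%:R by rewrite ler_nat -ltnS.
by move=> ?; rewrite mulr_gt0 // ?ltr0n //; lra.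
Qed.

Lemma parabola_mass_gt0 : 0 < parabola_mass.
Proof.
rewrite /parabola_mass (bigD1 ord0) //= ltr_pwDl ?exprn_gt0 //.
  exact: (parabola_gt0 ord0).
by apply: sumr_ge0 => k _; exact: sqr_ge0.
Qed.

Lemma kernel_coef_ge0 m : 0 <= kernel_coef m.
Proof.
apply: divr_ge0; last exact: ltW parabola_mass_gt0.
apply: sumr_ge0 => k _; apply: sumr_ge0 => l _.
by rewrite mulr_ge0 // ltW // parabola_gt0.
Qed.

(** By [2 u v <= u ^+ 2 + v ^+ 2] it is enough to count: each index has at most
    [freq_weight m] indices at distance [m]. *)
Lemma kernel_coef_le m : kernel_coef m <= freq_weight m.
Proof.
rewrite ler_pdivrMr ?parabola_mass_gt0 //.
have card_le (k : 'I_T.+1) : (#|[pred l : 'I_T.+1 | `|k%:Z - l%:Z|%N == m]|%:R : R)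
    <= freq_weight m.
  rewrite /freq_weight; case: (eqVneq m 0) => [->|_].
    rewrite lern1 -(card1 k); apply: subset_leq_card; apply/fintype.subsetP => l.
    by rewrite !inE => kl; apply/eqP/val_inj => /=; lia.
  rewrite ler_nat.
  apply: (@leq_trans #|pred2 (inord (k - m) : 'I_T.+1) (inord (k + m))|).
    apply: subset_leq_card; apply/fintype.subsetP => l; rewrite !inE => kl.
    apply/orP; have := ltn_ord l; case: (leqP l k) => lk lT; [left|right];
      by apply/eqP/val_inj; rewrite /= inordK; lia.
  by rewrite card2; case: (_ != _).
have sym : \sum_(k < T.+1) \sum_(l < T.+1 | `|k%:Z - l%:Z|%N == m)
      parabola l ^+ 2 =
    \sum_(k < T.+1) \sum_(l < T.+1 | `|k%:Z - l%:Z|%N == m) parabola k ^+ 2.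
  rewrite (exchange_big_dep xpredT) //=.
  apply: eq_bigr => k _.
  by apply: eq_bigl => l; rewrite distnC.
apply: (@le_trans _ _ (\sum_(k < T.+1) \sum_(l < T.+1 | `|k%:Z - l%:Z|%N == m)
    parabola k ^+ 2)).
  apply: (@le_trans _ _ (2^-1 * (\sum_(k < T.+1)
     \sum_(l < T.+1 | `|k%:Z - l%:Z|%N == m) parabola k ^+ 2 +
     \sum_(k < T.+1) \sum_(l < T.+1 | `|k%:Z - l%:Z|%N == m) parabola l ^+ 2))).
    rewrite -big_split mulr_sumr; apply: ler_sum => k _ /=.
    rewrite -big_split mulr_sumr; apply: ler_sum => l _ /=.
    by have := sqr_ge0 (parabola k - parabola l); nra.
  by rewrite sym; lra.
rewrite /parabola_mass mulr_sumr; apply: ler_sum => k _.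
rewrite sumr_const -mulr_natl ler_wpM2r ?sqr_ge0 //.
exact: card_le.
Qed.

Lemma parabola_form_ge0 t : 0 <= \sum_(k < T.+1) \sum_(l < T.+1)
    parabola k * parabola l * cos (pi * (k%:Z - l%:Z)%:~R * t).
Proof.
have -> : \sum_(k < T.+1) \sum_(l < T.+1)
    parabola k * parabola l * cos (pi * (k%:Z - l%:Z)%:~R * t) =
    (\sum_(k < T.+1) parabola k * cos (pi * k%:R * t)) ^+ 2 +
    (\sum_(k < T.+1) parabola k * sin (pi * k%:R * t)) ^+ 2.
  rewrite !expr2 !mulr_suml -big_split /=; apply: eq_bigr => k _.
  rewrite !mulr_sumr -big_split /=; apply: eq_bigr => l _.
  rewrite intrB -!pmulrn.
  have -> : pi * (k%:R - l%:R) * t = pi * k%:R * t - pi * l%:R * t by ring.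
  by rewrite cosB; ring.
by rewrite addr_ge0 ?sqr_ge0.
Qed.

Lemma sum_sqr_parabola (K : nat) (M : R) :
  \sum_(k < K) (k.+1%:R * (M - k.+1%:R)) ^+ 2 =
  M ^+ 2 * (K%:R * (K%:R + 1) * (2 * K%:R + 1)) / 6
  - M * K%:R ^+ 2 * (K%:R + 1) ^+ 2 / 2
  + K%:R * (K%:R + 1) * (2 * K%:R + 1) * (3 * K%:R ^+ 2 + 3 * K%:R - 1) / 30.
Proof.
elim: K => [|K IH]; first by rewrite big_ord0; field.
by rewrite big_ord_recr /= IH -!natr1; field.
Qed.

Lemma sum_parabola_increment (K : nat) (M : R) :
  \sum_(k < K) k.+1%:R * (M - k.+1%:R) * (2 * k.+1%:R + 1 - M) =
  - M * (M - 1) * K%:R * (K%:R + 1) / 2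
  + (3 * M - 1) * (K%:R * (K%:R + 1) * (2 * K%:R + 1)) / 6
  - K%:R ^+ 2 * (K%:R + 1) ^+ 2 / 2.
Proof.
elim: K => [|K IH]; first by rewrite big_ord0; field.
by rewrite big_ord_recr /= IH -!natr1; field.
Qed.

(** The two sums equal [M (M ^+ 2 - 1) / 6] and [M (M ^+ 4 - 1) / 30] with
    [M = T + 2]. *)
Lemma parabola_autocorrelation : T.+2%:R ^+ 2 *
  (parabola_mass - \sum_(k < T.+1) parabola k * parabola k.+1) <=
  5 * parabola_mass.
Proof.
have -> : parabola_mass - \sum_(k < T.+1) parabola k * parabola k.+1 =
    \sum_(k < T.+1) k.+1%:R * (T.+2%:R - k.+1%:R) * (2 * k.+1%:R + 1 - T.+2%:R).
  rewrite /parabola_mass -sumrB; apply: eq_bigr => k _.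
  by rewrite /parabola -!natr1; ring.
rewrite sum_parabola_increment.
have -> : parabola_mass = \sum_(k < T.+1) (k.+1%:R * (T.+2%:R - k.+1%:R)) ^+ 2.
  by apply: eq_bigr => k _; rewrite /parabola -!natr1; congr (_ ^+ 2); ring.
rewrite sum_sqr_parabola -[T.+2%:R]natr1.
set M := T.+1%:R.
have M1 : 1 <= M by rewrite ler1n.
rewrite -subr_ge0.
set D := (X in 0 <= X).
have -> : D = (M + 1) * M * (M + 2) / 6 by rewrite /D; field.
by rewrite divr_ge0 // !mulr_ge0 //; lra.
Qed.

End Parabola.

Section SmoothingKernel.
Context {R : realType} (n T : nat).
Hypothesis n_gt0 : (0 < n)%N.
Hypothesis T_lt_n : (T < n)%N.

Local Notation parabola := (@parabola R T).
Local Notation parabola_mass := (@parabola_mass R T).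
Local Notation kernel_coef := (@kernel_coef R T).

Let nR : (n%:R : R) != 0. Proof. by rewrite pnatr_eq0 -lt0n. Qed.
Let B0 : parabola_mass != 0. Proof. by rewrite gt_eqF ?parabola_mass_gt0. Qed.

(** The kernel is folded evenly at 0 and 1, which leaves cosines only, and is
    normalized by the number of nodes. *)
Definition smoothing_kernel (x : R) (y : nat) : R :=
  n%:R^-1 * \sum_(m < T.+1) kernel_coef m *
    (cos (pi * m%:R * x) * cos (pi * m%:R * node n y)).

Lemma smoothing_kernelE x y : smoothing_kernel x y =
  (n%:R * parabola_mass)^-1 * \sum_(k < T.+1) \sum_(l < T.+1)
    parabola k * parabola l * (2^-1 *
      (cos (pi * (k%:Z - l%:Z)%:~R * (x - node n y)) +
       cos (pi * (k%:Z - l%:Z)%:~R * (x + node n y)))).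
Proof.
rewrite /smoothing_kernel invfM -mulrA; congr (_ * _).
pose g (m : nat) : R := cos (pi * m%:R * x) * cos (pi * m%:R * node n y).
have gE (r : int) : 2^-1 * (cos (pi * r%:~R * (x - node n y)) +
    cos (pi * r%:~R * (x + node n y))) = g `|r|%N.
  have cosabs z : cos (pi * `|r|%N%:R * z) = cos (pi * r%:~R * z) :> R.
    rewrite natr_absz; have [r0|r0] := leP 0 r; first by rewrite ger0_norm.
    by rewrite ltr0_norm // intrN mulrN mulNr cosN.
  by rewrite /g !cosabs [_ * (x - _)]mulrBr [_ * (x + _)]mulrDr cosB cosD; field.
under [X in _ = _ * X]eq_bigr => k _ do under eq_bigr => l _ do rewrite gE.
rewrite pair_bigA /=.
pose df (u : 'I_T.+1 * 'I_T.+1) : 'I_T.+1 := inord `|u.1%:Z - u.2%:Z|%N.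
have dfE u : df u = `|u.1%:Z - u.2%:Z|%N :> nat.
  by rewrite inordK //; have := ltn_ord u.1; have := ltn_ord u.2; lia.
rewrite (partition_big df xpredT) //= mulr_sumr; apply: eq_bigr => m _.
rewrite /kernel_coef mulrAC [RHS]mulrC; congr (_ / _).
rewrite pair_big_dep mulr_suml /=.
rewrite (eq_bigl (fun u => df u == m)) => [|u]; last first.
  by rewrite -(inj_eq val_inj) /= dfE.
by apply: eq_bigr => u /eqP <-; rewrite -dfE.
Qed.

Lemma smoothing_kernel_ge0 x y : 0 <= smoothing_kernel x y.
Proof.
rewrite smoothing_kernelE mulr_ge0 //.
  by rewrite invr_ge0 mulr_ge0 ?ler0n ?ltW ?parabola_mass_gt0.
have H s t : 2^-1 * (\sum_(k < T.+1) \sum_(l < T.+1)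
      parabola k * parabola l * cos (pi * (k%:Z - l%:Z)%:~R * s) +
      \sum_(k < T.+1) \sum_(l < T.+1)
      parabola k * parabola l * cos (pi * (k%:Z - l%:Z)%:~R * t)) =
    \sum_(k < T.+1) \sum_(l < T.+1) parabola k * parabola l *
      (2^-1 * (cos (pi * (k%:Z - l%:Z)%:~R * s) +
               cos (pi * (k%:Z - l%:Z)%:~R * t))).
  rewrite -big_split mulr_sumr; apply: eq_bigr => k _ /=.
  by rewrite -big_split mulr_sumr; apply: eq_bigr => l _ /=; ring.
by rewrite -H mulr_ge0 ?invr_ge0 // addr_ge0 // parabola_form_ge0.
Qed.

Lemma smoothing_kernel_sum1 x : \sum_(y < n) smoothing_kernel x y = 1.
Proof.
under eq_bigr do rewrite smoothing_kernelE.
rewrite -mulr_sumr exchange_big /=.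
rewrite (eq_bigr (fun k : 'I_T.+1 => n%:R * parabola k ^+ 2)) => [|k _].
  by rewrite -mulr_sumr mulVf // mulf_neq0.
rewrite exchange_big /= (bigD1 k) //= [X in _ + X]big1 => [|l lk].
  rewrite addr0 -mulr_sumr sum_cos_node_conv // subrr //; last by lia.
  by rewrite mulr1n mulr1 expr2 mulrC.
have := ltn_ord l; have := ltn_ord k; move=> kT lT.
rewrite -mulr_sumr sum_cos_node_conv //; last by lia.
rewrite (_ : (k%:Z - l%:Z == 0) = false) ?mulr0 //.
apply/eqP => kl; move/eqP: lk; apply; apply/val_inj => /=; lia.
Qed.

(** The squared distance is bounded by half of [1 - cos], whose average against
    the kernel is a quadratic form in the parabola: the mean over the nodes
    keeps the frequency 0 only, that is the terms [k = l] and [k = l +- 1]. *)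
Lemma smoothing_kernel_moment x : 0 <= x <= 1 ->
  \sum_(y < n) smoothing_kernel x y * (x - node n y) ^+ 2 <=
  5 / 2 / T.+2%:R ^+ 2.
Proof.
move=> x01.
pose c (k l : nat) t := cos (pi * (k%:Z - l%:Z)%:~R * t) : R.
pose form t := \sum_(k < T.+1) \sum_(l < T.+1) parabola k * parabola l * c k l t.
have kernelE y : smoothing_kernel x y = (n%:R * parabola_mass)^-1 * (2^-1 *
    (form (x - node n y) + form (x + node n y))).
  rewrite smoothing_kernelE; congr (_ * _).
  rewrite -big_split mulr_sumr; apply: eq_bigr => k _ /=.
  by rewrite -big_split mulr_sumr; apply: eq_bigr => l _ /=; rewrite /c; ring.
have nB0 : 0 < (n%:R * parabola_mass)^-1.
  by rewrite invr_gt0 mulr_gt0 ?ltr0n // parabola_mass_gt0.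
have form0 t : 0 <= form t by exact: parabola_form_ge0.
pose defect t := form t * (1 - cos (pi * t)).
apply: (@le_trans _ _ ((n%:R * parabola_mass)^-1 * (2^-1 * \sum_(y < n) (2^-1 *
    (defect (x - node n y) + defect (x + node n y)))))).
  set A := (n%:R * parabola_mass)^-1; rewrite !mulr_sumr; apply: ler_sum => y _.
  rewrite kernelE -/A -mulrA ler_pM2l // -mulrA ler_pM2l ?invr_gt0 //.
  have y01 := @node01 R n n_gt0 _ (ltn_ord y).
  have H1 := ler_wpM2l (form0 (x - node n y)) (sqr_dist_le_cosB _ _ x01 y01).
  have H2 := ler_wpM2l (form0 (x + node n y)) (sqr_dist_le_cosD _ _ x01 y01).
  by rewrite /defect; lra.
pose q (r : int) : R := \sum_(y < n) (2^-1 * (cos (pi * r%:~R * (x - node n y)) +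
   cos (pi * r%:~R * (x + node n y)))).
have qE r : (`|r| < n + n)%N -> q r = n%:R * (r == 0)%:R.
  exact: sum_cos_node_conv.
have defectE t : defect t = \sum_(k < T.+1) \sum_(l < T.+1)
    parabola k * parabola l * (c k l t - 2^-1 * c k.+1 l t - 2^-1 * c k l.+1 t).
  rewrite /defect /form mulr_suml; apply: eq_bigr => k _.
  rewrite mulr_suml; apply: eq_bigr => l _.
  rewrite -mulrA; congr (_ * _); rewrite /c !intrB -!pmulrn -!natr1.
  have -> : pi * (k%:R + 1 - l%:R) * t = pi * (k%:R - l%:R) * t + pi * t :> R.
    by ring.
  have -> : pi * (k%:R - (l%:R + 1)) * t = pi * (k%:R - l%:R) * t - pi * t :> R.
    by ring.
  by rewrite cosB cosD; field.
have avg_defect : \sum_(y < n) (2^-1 *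
      (defect (x - node n y) + defect (x + node n y))) =
    \sum_(k < T.+1) \sum_(l < T.+1) parabola k * parabola l *
      (q (k%:Z - l%:Z) - 2^-1 * q (k.+1%:Z - l%:Z) - 2^-1 * q (k%:Z - l.+1%:Z)).
  transitivity (\sum_(y < n) \sum_(k < T.+1) \sum_(l < T.+1)
    parabola k * parabola l * (2^-1 *
    ((c k l (x - node n y) - 2^-1 * c k.+1 l (x - node n y)
      - 2^-1 * c k l.+1 (x - node n y)) +
     (c k l (x + node n y) - 2^-1 * c k.+1 l (x + node n y)
      - 2^-1 * c k l.+1 (x + node n y))))).
    apply: eq_bigr => y _; rewrite !defectE -big_split mulr_sumr.
    apply: eq_bigr => k _ /=; rewrite -big_split mulr_sumr.
    by apply: eq_bigr => l _ /=; ring.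
  rewrite exchange_big; apply: eq_bigr => k _ /=.
  rewrite exchange_big; apply: eq_bigr => l _ /=.
  rewrite -mulr_sumr; congr (_ * _); rewrite /q !mulr_sumr -!sumrB.
  by apply: eq_bigr => y _; rewrite /c; ring.
(* for k = T the right-hand side vanishes with the parabola at T + 1 *)
have corr (k : 'I_T.+1) : \sum_(l < T.+1) parabola k * parabola l *
    (k.+1%:Z - l%:Z == 0)%:R = parabola k * parabola k.+1.
  have [kT|kT] := ltnP k.+1 T.+1.
    rewrite (bigD1 (Ordinal kT)) //= subrr eqxx mulr1n mulr1 big1 ?addr0 // => l lk.
    rewrite (_ : (_ == 0) = false) ?mulr0 //; apply/eqP => kl.
    by move/eqP: lk; apply; apply/val_inj => /=; lia.
  have kTE : k = T :> nat by have := ltn_ord k; lia.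
  rewrite [X in _ = _ * X](_ : _ = 0); last first.
    by rewrite /parabola kTE -[T.+1%:R]natr1; ring.
  rewrite mulr0 big1 // => l _; rewrite (_ : (_ == 0) = false) ?mulr0 //.
  by apply/eqP; have := ltn_ord l; lia.
have -> : \sum_(y < n) (2^-1 * (defect (x - node n y) + defect (x + node n y))) =
    n%:R * (parabola_mass - \sum_(k < T.+1) parabola k * parabola k.+1).
  rewrite avg_defect.
  transitivity (\sum_(k < T.+1) \sum_(l < T.+1) (n%:R * (parabola k * parabola l *
      (k%:Z - l%:Z == 0)%:R) - 2^-1 * n%:R * (parabola k * parabola l *
      (k.+1%:Z - l%:Z == 0)%:R) - 2^-1 * n%:R * (parabola l * parabola k *
      (l.+1%:Z - k%:Z == 0)%:R))).
    apply: eq_bigr => k _; apply: eq_bigr => l _.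
    have := ltn_ord l; have := ltn_ord k; move=> kT lT.
    rewrite !qE; try lia.
    rewrite -(opprB l.+1%:Z) oppr_eq0; ring.
  under eq_bigr do rewrite !sumrB -!mulr_sumr.
  rewrite !sumrB -!mulr_sumr (exchange_big _ _ _ _ _
    (fun k l : 'I_T.+1 => parabola l * parabola k * (l.+1%:Z - k%:Z == 0)%:R)) /=.
  have -> : \sum_(k < T.+1) \sum_(l < T.+1) parabola k * parabola l *
      (k.+1%:Z - l%:Z == 0)%:R = \sum_(k < T.+1) parabola k * parabola k.+1.
    by apply: eq_bigr => k _; exact: corr.
  rewrite (_ : \sum_(k < T.+1) \sum_(l < T.+1) _ = parabola_mass); last first.
    apply: eq_bigr => k _; rewrite (bigD1 k) //= subrr eqxx mulr1n mulr1 -expr2.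
    rewrite big1 ?addr0 // => l lk; rewrite (_ : (_ == 0) = false) ?mulr0 //.
    by apply/eqP => kl; move/eqP: lk; apply; apply/val_inj => /=; lia.
  by field.
set C := \sum_(k < T.+1) _.
have H := @parabola_autocorrelation R T; rewrite -/C in H.
rewrite mulrCA.
have -> : (n%:R * parabola_mass)^-1 * (n%:R * (parabola_mass - C)) =
   (parabola_mass - C) / parabola_mass by field; rewrite B0 nR.
have M0 : 0 < (T.+2%:R : R) ^+ 2 by rewrite exprn_gt0 // ltr0n.
rewrite ler_pdivlMr // -mulrA [_ / _ * _]mulrAC -mulrA.
rewrite (_ : 5 / 2 = 2^-1 * 5); last by field.
rewrite ler_pM2l ?invr_gt0 // mulrA ler_pdivrMr ?parabola_mass_gt0 //.
by rewrite [X in X <= _]mulrC.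
Qed.

End SmoothingKernel.

(** * The Euclidean norm *)

Section EuclideanNorm.
Context {R : realType} {I : finType}.
Implicit Types u v w : I -> R.

Definition norm2 u : R := Num.sqrt (\sum_i u i ^+ 2).

Lemma norm2_ge0 u : 0 <= norm2 u. Proof. exact: sqrtr_ge0. Qed.

Lemma sqr_norm2 u : norm2 u ^+ 2 = \sum_i u i ^+ 2.
Proof. by rewrite sqr_sqrtr // sumr_ge0 // => i _; exact: sqr_ge0. Qed.

Lemma cauchy_schwarz_sum u v : \sum_i u i * v i <= norm2 u * norm2 v.
Proof.
have zero w : norm2 w = 0 -> forall i, w i = 0.
  move=> w0 i; have : \sum_i w i ^+ 2 == 0 by rewrite -sqr_norm2 w0 expr0n.
  rewrite psumr_eq0 => [/allP/(_ i (mem_index_enum _))|j _]; last exact: sqr_ge0.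
  by rewrite sqrf_eq0 => /eqP.
have [/zero u0|u0] := eqVneq (norm2 u) 0.
  by rewrite big1 ?mulr_ge0 ?norm2_ge0 // => i _; rewrite u0 mul0r.
have [/zero v0|v0] := eqVneq (norm2 v) 0.
  by rewrite big1 ?mulr_ge0 ?norm2_ge0 // => i _; rewrite v0 mulr0.
have uv0 : 0 < norm2 u * norm2 v by rewrite mulr_gt0 // lt0r norm2_ge0 ?u0 ?v0.
have : 0 <= \sum_i (norm2 v * u i - norm2 u * v i) ^+ 2.
  by apply: sumr_ge0 => i _; exact: sqr_ge0.
have -> : \sum_i (norm2 v * u i - norm2 u * v i) ^+ 2 =
    norm2 v ^+ 2 * norm2 u ^+ 2 + norm2 u ^+ 2 * norm2 v ^+ 2
    - 2 * (norm2 u * norm2 v) * \sum_i u i * v i.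
  transitivity (norm2 v ^+ 2 * (\sum_i u i ^+ 2) + norm2 u ^+ 2 *
      (\sum_i v i ^+ 2) - 2 * (norm2 u * norm2 v) * \sum_i u i * v i).
    rewrite !mulr_sumr -big_split -sumrB.
    by apply: eq_bigr => i _ /=; ring.
  by rewrite -!sqr_norm2.
have -> : norm2 v ^+ 2 * norm2 u ^+ 2 + norm2 u ^+ 2 * norm2 v ^+ 2
    - 2 * (norm2 u * norm2 v) * (\sum_i u i * v i) =
    2 * ((norm2 u * norm2 v) * (norm2 u * norm2 v - \sum_i u i * v i)) by ring.
by rewrite pmulr_rge0 // pmulr_rge0 // subr_ge0.
Qed.

Lemma ler_norm2D u v : norm2 (fun i => u i + v i) <= norm2 u + norm2 v.
Proof.
rewrite -ler_sqr ?nnegrE ?addr_ge0 ?norm2_ge0 // sqr_norm2.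
have -> : \sum_i (u i + v i) ^+ 2 =
    norm2 u ^+ 2 + norm2 v ^+ 2 + 2 * \sum_i u i * v i.
  rewrite !sqr_norm2 mulr_sumr -!big_split; apply: eq_bigr => i _ /=; ring.
by have := cauchy_schwarz_sum u v; rewrite sqrrD -mulr_natl; lra.
Qed.

Lemma norm2_le u (r : R) : 0 <= r -> (forall i, `|u i| <= r) ->
  norm2 u <= Num.sqrt #|I|%:R * r.
Proof.
move=> r0 ur; rewrite -ler_sqr ?nnegrE ?mulr_ge0 ?sqrtr_ge0 ?norm2_ge0 //.
rewrite sqr_norm2 exprMn sqr_sqrtr ?ler0n // mulr_natl -sumr_const.
apply: ler_sum => i _; rewrite -(@real_normK _ (u i)) ?num_real //.
by rewrite ler_sqr ?nnegrE.
Qed.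

Lemma norm2_le_amgm u (r : R) : 0 < r -> norm2 u <= 2^-1 * (norm2 u ^+ 2 / r + r).
Proof.
move=> r0; have := sqr_ge0 (norm2 u - r).
have : norm2 u ^+ 2 / r * r = norm2 u ^+ 2 by rewrite divfK ?gt_eqF.
by move=> *; nra.
Qed.

End EuclideanNorm.

(** * Discrete cosine analysis of Lipschitz functions on the grid *)

Section Grid.
Context {R : realType} (d n T : nat).
Hypothesis n_gt0 : (0 < n)%N.
Hypothesis T_lt_n : (T < n)%N.

Let nR : (n%:R : R) != 0. Proof. by rewrite pnatr_eq0 -lt0n. Qed.
Let nR0 : 0 < (n%:R : R). Proof. by rewrite ltr0n. Qed.

Local Notation grid := {ffun 'I_d -> 'I_n}.
Local Notation freq := {ffun 'I_d -> 'I_T.+1}.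
Implicit Types (x : 'I_d -> R) (y : grid) (m l : freq) (f g : grid -> R).

Definition grid_point y (i : 'I_d) : R := node n (y i).

Definition mode m x : R := \prod_i cos (pi * (m i)%:R * x i).

(** The number of vectors of Z^d whose coordinates have absolute values [m]. *)
Definition mode_weight m : R := \prod_i freq_weight (m i).

Definition mode_coef f m : R :=
  n%:R ^- d * \sum_y f y * mode m (grid_point y).

Definition mode_eigen m : R := \sum_i laplace_eigen n (m i).

Definition tensor_kernel x y : R := \prod_i smoothing_kernel n T (x i) (y i).

Definition smoothed f x : R := \sum_y f y * tensor_kernel x y.

Lemma tensor_kernel_ge0 x y : 0 <= tensor_kernel x y.
Proof. by apply: prodr_ge0 => i _; exact: smoothing_kernel_ge0. Qed.

Lemma tensor_kernel_sum1 x : \sum_y tensor_kernel x y = 1.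
Proof.
rewrite -(bigA_distr_bigA (fun i (k : 'I_n) => smoothing_kernel n T (x i) k)).
by rewrite big1 // => i _; rewrite smoothing_kernel_sum1.
Qed.

Lemma tensor_kernel_moment x : (forall i, 0 <= x i <= 1) ->
  \sum_y tensor_kernel x y * \sum_i (x i - grid_point y i) ^+ 2 <=
  d%:R * (5 / 2 / T.+2%:R ^+ 2).
Proof.
move=> x01; under eq_bigr do rewrite mulr_sumr.
rewrite exchange_big /=.
have -> : d%:R * (5 / 2 / T.+2%:R ^+ 2) = \sum_(i < d) (5 / 2 / T.+2%:R ^+ 2) :> R.
  by rewrite sumr_const card_ord mulr_natl.
apply: ler_sum => i _.
pose F (j : 'I_d) (k : 'I_n) : R := smoothing_kernel n T (x j) k *
   (if j == i then (x i - node n k) ^+ 2 else 1).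
rewrite (eq_bigr (fun y : grid => \prod_j F j (y j))) => [|y _]; last first.
  rewrite /tensor_kernel [in RHS](bigD1 i) //= [in LHS](bigD1 i) //= /F eqxx.
  rewrite mulrAC; congr (_ * _); apply: eq_bigr => j /negbTE ->.
  by rewrite mulr1.
rewrite -bigA_distr_bigA (bigD1 i) //= [X in _ * X]big1 => [|j /negbTE ji].
  rewrite mulr1 /F eqxx; exact: smoothing_kernel_moment.
rewrite /F ji; under eq_bigr do rewrite mulr1.
exact: smoothing_kernel_sum1.
Qed.

Lemma smoothed_expansion f x : smoothed f x =
  \sum_(m : freq) (\prod_i kernel_coef T (m i)) * mode_coef f m * mode m x.
Proof.
pose c (i : 'I_d) (y : grid) (k : 'I_T.+1) : R := kernel_coef T k *
   (cos (pi * k%:R * x i) * cos (pi * k%:R * grid_point y i)).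
have tkE y : tensor_kernel x y = n%:R ^- d *
    \sum_(m : freq) (\prod_i kernel_coef T (m i)) * (mode m x * mode m (grid_point y)).
  rewrite /tensor_kernel /smoothing_kernel big_split /= prodr_const card_ord.
  rewrite exprVn; congr (_ * _).
  rewrite (bigA_distr_bigA (fun i => c i y)); apply: eq_bigr => m _.
  by rewrite /mode -!big_split.
rewrite /smoothed; under eq_bigr do rewrite tkE mulrCA mulr_sumr.
rewrite -mulr_sumr exchange_big /= mulr_sumr; apply: eq_bigr => m _.
rewrite /mode_coef !mulr_sumr mulr_suml; apply: eq_bigr => y _; ring.
Qed.

Lemma freq_weight_gt0 (k : nat) : 0 < freq_weight k :> R.
Proof. by rewrite /freq_weight; case: ifP. Qed.

Lemma mode_weight_gt0 m : 0 < mode_weight m.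
Proof. by apply: prodr_gt0 => i _; exact: freq_weight_gt0. Qed.

Lemma mode_orthogonal m l :
  \sum_(y : grid) mode m (grid_point y) * mode l (grid_point y) =
  (m == l)%:R * (n%:R ^+ d / mode_weight m).
Proof.
pose F (i : 'I_d) (k : 'I_n) : R :=
  cos (pi * (m i)%:R * node n k) * cos (pi * (l i)%:R * node n k).
rewrite (eq_bigr (fun y : grid => \prod_i F i (y i))) => [|y _]; last first.
  by rewrite -big_split.
have lt_n (k : 'I_T.+1) : (k < n)%N by exact: leq_trans (ltn_ord k) T_lt_n.
rewrite -bigA_distr_bigA.
rewrite (eq_bigr (fun i => (m i == l i)%:R * (n%:R / freq_weight (m i)))); last first.
  by move=> i _; rewrite sum_cos_cos_node // mulrCA mulrA.
have [<-|ml] := eqVneq m l.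
  under eq_bigr do rewrite eqxx mul1r.
  by rewrite mul1r prodf_div prodr_const card_ord.
rewrite mul0r; have [i mli] : exists i, m i != l i.
  apply/existsP; apply: contraNT ml; rewrite negb_exists => /forallP H.
  by apply/eqP/ffunP => i; apply/eqP; rewrite -[_ == _]negbK.
by rewrite (bigD1 i) //= (negbTE mli) !mul0r.
Qed.

(** Cyclic shift in one coordinate: a bijection, so that sums can be reindexed;
    [grid_diff] cancels the step that leaves the grid. *)
Definition grid_shift (i : 'I_d) y : grid :=
  [ffun j => if j == i then ordS (y j) else y j].

Definition grid_unshift (i : 'I_d) y : grid :=
  [ffun j => if j == i then ord_pred (y j) else y j].

Lemma grid_unshiftK i : cancel (grid_unshift i) (grid_shift i).
Proof.
by move=> y; apply/ffunP => j; rewrite !ffunE; case: eqP => // _; rewrite ord_predK.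
Qed.

Definition grid_diff (i : 'I_d) f y : R :=
  if y i == n.-1 :> nat then 0 else f (grid_shift i y) - f y.

Definition energy f g : R :=
  \sum_i \sum_y grid_diff i f y * grid_diff i g y.

Lemma grid_diff_mode i m y :
  grid_diff i (fun y => mode m (grid_point y)) y = cos_diff n (m i) (y i) *
  \prod_(j | j != i) cos (pi * (m j)%:R * grid_point y j).
Proof.
rewrite /grid_diff; have [->|yi] := eqVneq (y i : nat) n.-1.
  by rewrite cos_diff_last // mul0r.
rewrite /mode (bigD1 i) //= [X in _ - X](bigD1 i) //= mulrBl.
have yiS : ordS (y i) = (y i).+1 :> nat.
  by rewrite /= modn_small //; have := ltn_ord (y i); lia.
congr (_ - _); first last.
rewrite /grid_point {1}/grid_shift ffunE eqxx yiS; congr (_ * _).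
by apply: eq_bigr => j /negbTE ji; rewrite ffunE ji.
Qed.

(** Summation by parts; the boundary terms vanish with [cos_diff]. *)
Lemma energy_mode f m : energy f (fun y => mode m (grid_point y)) =
  mode_eigen m * \sum_y f y * mode m (grid_point y).
Proof.
rewrite /energy /mode_eigen mulr_suml; apply: eq_bigr => i _.
pose rest y := \prod_(j | j != i) cos (pi * (m j)%:R * grid_point y j).
pose s y := cos_diff n (m i) (y i) * rest y.
transitivity (\sum_y (f (grid_shift i y) - f y) * s y).
  apply: eq_bigr => y _; rewrite grid_diff_mode -/(rest y) -/(s y) /grid_diff.
  by case: eqP => // yi; rewrite /s yi cos_diff_last // !(mul0r, mulr0).
under eq_bigr do rewrite mulrBl.
rewrite sumrB (reindex_inj (can_inj (grid_unshiftK i))) /= -sumrB mulr_sumr.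
apply: eq_bigr => y _; rewrite grid_unshiftK -mulrBr mulrCA; congr (_ * _).
rewrite /mode (bigD1 i) //= -/(rest y) mulrA.
have -> : s (grid_unshift i y) = cos_diff n (m i) (ord_pred (y i)) * rest y.
  rewrite /s ffunE eqxx; congr (_ * _); apply: eq_bigr => j /negbTE ji.
  by rewrite /grid_point ffunE ji.
rewrite /s -mulrBl; congr (_ * _); rewrite /grid_point.
have [yi0|yi0] := posnP (y i).
  have -> : ord_pred (y i) = n.-1 :> nat.
    by rewrite /= yi0 add0n modn_small // prednK.
  by rewrite cos_diff_last // sub0r yi0 cos_diff_first.
have -> : ord_pred (y i) = (y i).-1 :> nat.
  rewrite /= (_ : (y i + n).-1 = (y i).-1 + n)%N; last by lia.
  by rewrite modnDr modn_small //; have := ltn_ord (y i); lia.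
by rewrite -{2 3}(prednK yi0) cos_diff_succ.
Qed.

Lemma mode_eigen_ge0 m : 0 <= mode_eigen m.
Proof. by apply: sumr_ge0 => i _; exact: laplace_eigen_ge0. Qed.

(** Bessel's inequality for the energy: expand [0 <= energy (f - p) (f - p)]
    for the projection [p] of [f] on the low frequencies. *)
Lemma energy_bessel f :
  n%:R ^+ d * \sum_(m : freq) mode_weight m * mode_eigen m * mode_coef f m ^+ 2 <=
  energy f f.
Proof.
pose a m := mode_weight m * mode_coef f m.
pose p y := \sum_(m : freq) a m * mode m (grid_point y).
have diff_p i y : grid_diff i p y =
    \sum_(m : freq) a m * grid_diff i (fun y => mode m (grid_point y)) y.
  rewrite /grid_diff /p; case: eqP => _; last first.
    by rewrite -sumrB; apply: eq_bigr => m _; rewrite mulrBr.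
  by rewrite big1 // => m _; rewrite mulr0.
have energy_p g : energy g p =
    \sum_(m : freq) a m * (mode_eigen m * \sum_y g y * mode m (grid_point y)).
  transitivity (\sum_(m : freq) a m * energy g (fun y => mode m (grid_point y))).
    rewrite /energy; under eq_bigr => i _.
      under eq_bigr => y _ do rewrite diff_p mulr_sumr.
      rewrite exchange_big /=.
      over.
    rewrite exchange_big /=; apply: eq_bigr => m _.
    rewrite mulr_sumr; apply: eq_bigr => i _; rewrite mulr_sumr.
    by apply: eq_bigr => y _; ring.
  by apply: eq_bigr => m _; rewrite energy_mode.
have nd0 : (n%:R ^+ d : R) != 0 by rewrite expf_neq0.
have inner_p m : \sum_y p y * mode m (grid_point y) = n%:R ^+ d * mode_coef f m.
  under eq_bigr do rewrite mulr_suml.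
  rewrite exchange_big /= (bigD1 m) //= [X in _ + X]big1 ?addr0 => [|l lm].
    under eq_bigr do rewrite -mulrA.
    rewrite -mulr_sumr mode_orthogonal eqxx mul1r /a.
    by field; rewrite gt_eqF ?mode_weight_gt0.
  under eq_bigr do rewrite -mulrA.
  by rewrite -mulr_sumr mode_orthogonal (negbTE lm) mul0r mulr0.
have inner_f m : \sum_y f y * mode m (grid_point y) = n%:R ^+ d * mode_coef f m.
  by rewrite /mode_coef mulrA mulfV // mul1r.
pose S := n%:R ^+ d * \sum_(m : freq) mode_weight m * mode_eigen m * mode_coef f m ^+ 2.
have fpS : energy f p = S.
  rewrite energy_p /S mulr_sumr; apply: eq_bigr => m _.
  by rewrite inner_f /a; ring.
have ppS : energy p p = S.
  rewrite energy_p /S mulr_sumr; apply: eq_bigr => m _.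
  by rewrite inner_p /a; ring.
have : 0 <= \sum_i \sum_y (grid_diff i f y - grid_diff i p y) ^+ 2.
  by apply: sumr_ge0 => i _; apply: sumr_ge0 => y _; exact: sqr_ge0.
have -> : \sum_i \sum_y (grid_diff i f y - grid_diff i p y) ^+ 2 =
    energy f f - 2 * energy f p + energy p p.
  rewrite /energy mulr_sumr -sumrB -big_split; apply: eq_bigr => i _ /=.
  rewrite mulr_sumr -sumrB -big_split; apply: eq_bigr => y _ /=; ring.
by rewrite fpS ppS -/S; lra.
Qed.

Definition grid_dist y y' : R :=
  norm2 (fun i => grid_point y i - grid_point y' i).

Lemma grid_dist_triangle y1 y2 y3 :
  grid_dist y1 y3 <= grid_dist y1 y2 + grid_dist y2 y3.
Proof.
apply: le_trans (ler_norm2D _ _); rewrite /grid_dist /norm2.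
rewrite (eq_bigr (fun i => (grid_point y1 i - grid_point y2 i +
  (grid_point y2 i - grid_point y3 i)) ^+ 2)) // => i _.
by congr (_ ^+ 2); ring.
Qed.


Lemma grid_dist_refl y : grid_dist y y = 0.
Proof.
by rewrite /grid_dist /norm2 big1 ?sqrtr0 // => i _; rewrite subrr expr0n.
Qed.

(** Neighbouring grid points are at distance [1 / n]; bounding each of the [d]
    partial differences separately costs a factor [d]. *)
Lemma energy_lipschitz f :
  (forall y y', f y - f y' <= grid_dist y y') ->
  n%:R ^+ 2 * energy f f <= d%:R * n%:R ^+ d.
Proof.
move=> lip.
have diff_le i y : grid_diff i f y * grid_diff i f y <= n%:R ^- 2.
  rewrite /grid_diff; case: eqP => [_|/eqP yi].
    by rewrite mulr0 invr_ge0 exprn_ge0 ?ler0n.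
  have yiS : ordS (y i) = (y i).+1 :> nat.
    by rewrite /= modn_small //; have := ltn_ord (y i); lia.
  have distE : norm2 (fun j => grid_point (grid_shift i y) j - grid_point y j) =
      n%:R^-1.
    rewrite /norm2 (bigD1 i) //= big1 ?addr0 => [|j /negbTE ji]; last first.
      by rewrite /grid_point ffunE ji subrr expr0n.
    rewrite /grid_point ffunE eqxx yiS /node -natr1.
    have -> : ((y i)%:R + 1 + 2^-1) / n%:R - ((y i)%:R + 2^-1) / n%:R = n%:R^-1 :> R.
      by field.
    by rewrite sqrtr_sqr ger0_norm ?invr_ge0 ?ler0n.
  have H1 := lip (grid_shift i y) y; have H2 := lip y (grid_shift i y).
  rewrite /grid_dist distE in H1.
  have H2' : f y - f (grid_shift i y) <= n%:R^-1.
    rewrite -distE (le_trans H2) // /grid_dist /norm2 ler_wsqrtr //.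
    by apply: ler_sum => j _; rewrite -sqrrN opprB.
  rewrite -expr2 -exprVn -ler_sqrt ?exprn_ge0 ?invr_ge0 ?ler0n //.
  rewrite !sqrtr_sqr [X in _ <= X]ger0_norm ?invr_ge0 ?ler0n //.
  by rewrite ler_norml H1 andbT; lra.
have : energy f f <= \sum_(i < d) \sum_(y : grid) n%:R ^- 2.
  by apply: ler_sum => i _; apply: ler_sum => y _; exact: diff_le.
have -> : \sum_(i < d) \sum_(y : grid) n%:R ^- 2 = d%:R * n%:R ^+ d * n%:R ^- 2 :> R.
  rewrite !sumr_const card_ord card_ffun !card_ord -[_ *+ d]mulr_natl.
  by rewrite -[_ *+ (n ^ d)]mulr_natl natrX mulrA.
have n2 : 0 < (n%:R ^+ 2 : R) by rewrite exprn_gt0.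
by rewrite ler_pdivlMr // mulrC.
Qed.

(** The mean distance under the kernel is at most the square root of its second
    moment [d * (5 / 2) / (T + 2) ^+ 2], and 5 / 2 is less than 64 / 25. *)
Lemma smoothed_near f x y (k : R) :
  (forall y y', f y - f y' <= grid_dist y y') ->
  (0 < d)%N -> (forall i, 0 <= x i <= 1) ->
  norm2 (fun i => grid_point y i - x i) <= k ->
  `|f y - smoothed f x| <= k + Num.sqrt d%:R * (8 / 5) / T.+2%:R.
Proof.
move=> lip d0 x01 yx.
have fyE : f y - smoothed f x = \sum_z (f y - f z) * tensor_kernel x z.
  under eq_bigr do rewrite mulrBl.
  by rewrite sumrB -mulr_sumr tensor_kernel_sum1 mulr1.
have sd0 : 0 < Num.sqrt (d%:R : R) by rewrite sqrtr_gt0 ltr0n.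
have M0 : 0 < (T.+2%:R : R) by rewrite ltr0n.
pose r : R := Num.sqrt d%:R * (8 / 5) / T.+2%:R.
have r0 : 0 < r by rewrite divr_gt0 // mulr_gt0.
have distC z z' : grid_dist z z' = grid_dist z' z.
  rewrite /grid_dist /norm2; congr Num.sqrt; apply: eq_bigr => i _.
  by rewrite -sqrrN opprB.
have tri z : `|f y - f z| <= k + norm2 (fun i => x i - grid_point z i).
  apply: (@le_trans _ _ (grid_dist y z)).
    by rewrite ler_norml lip andbT lerNl opprB distC lip.
  apply: le_trans (lerD yx (lexx _)); apply: le_trans (ler_norm2D _ _).
  rewrite /grid_dist /norm2 ler_wsqrtr //; apply: ler_sum => i _.
  by rewrite addrA subrK.
rewrite fyE; apply: (le_trans (ler_norm_sum _ _ _)).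
apply: (@le_trans _ _ (\sum_z (k + 2^-1 * ((\sum_i (x i - grid_point z i) ^+ 2) / r + r))
   * tensor_kernel x z)).
  apply: ler_sum => z _; rewrite normrM (ger0_norm (tensor_kernel_ge0 x z)).
  rewrite ler_wpM2r ?tensor_kernel_ge0 // (le_trans (tri z)) // lerD2l.
  by rewrite -sqr_norm2; exact: norm2_le_amgm.
have -> : \sum_z (k + 2^-1 * ((\sum_i (x i - grid_point z i) ^+ 2) / r + r))
   * tensor_kernel x z = k + 2^-1 * ((\sum_z tensor_kernel x z *
       \sum_i (x i - grid_point z i) ^+ 2) / r + r).
  transitivity (\sum_z (k * tensor_kernel x z + 2^-1 * (tensor_kernel x z *
     (\sum_i (x i - grid_point z i) ^+ 2) / r + r * tensor_kernel x z))).
    by apply: eq_bigr => z _; ring.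
  rewrite big_split /= -!mulr_sumr big_split /= -mulr_suml -!mulr_sumr.
  by rewrite tensor_kernel_sum1 !mulr1.
rewrite -/r lerD2l.
have rr : d%:R = (r * T.+2%:R / (8 / 5)) ^+ 2 :> R.
  rewrite /r (_ : _ * _ / _ * _ / _ = Num.sqrt d%:R); last first.
    by field; rewrite !gt_eqF.
  by rewrite sqr_sqrtr ?ler0n.
have H := tensor_kernel_moment x x01.
have H' : (\sum_z tensor_kernel x z *
       \sum_i (x i - grid_point z i) ^+ 2) / r <= r.
  rewrite ler_pdivrMr // (le_trans H) // rr.
  have -> : (r * T.+2%:R / (8 / 5)) ^+ 2 * (5 / 2 / T.+2%:R ^+ 2) =
    r * r * (125 / 128) :> R by field; rewrite gt_eqF.
  by have := mulr_gt0 r0 r0; lra.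
lra.
Qed.

(** The value of a functional on the smoothed Lipschitz function is estimated
    mode by mode by the arithmetic-geometric mean inequality, with one
    parameter [t] for all modes. *)
Lemma smoothed_dual_bound f (U : freq -> R) (t : R) : (T + T <= n)%N -> 0 < t ->
  (forall y y', f y - f y' <= grid_dist y y') -> U [ffun=> ord0] = 0 ->
  \sum_(m : freq) (\prod_i kernel_coef T (m i)) * mode_coef f m * U m <=
  2^-1 * (t * d%:R + t^-1 * \sum_(m | m != [ffun=> ord0])
     mode_weight m * U m ^+ 2 / (8 * \sum_i (m i)%:R ^+ 2)).
Proof.
move=> TTn t0 lip U0.
set m0 : freq := [ffun=> ord0].
pose L m : R := n%:R ^+ 2 * mode_eigen m.
have L8 m : 8 * \sum_i (m i)%:R ^+ 2 <= L m.
  rewrite /L /mode_eigen !mulr_sumr; apply: ler_sum => i _.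
  by apply: laplace_eigen_ge => //; have := ltn_ord (m i); lia.
have m2_gt0 m : m != m0 -> 0 < 8 * (\sum_i (m i)%:R ^+ 2) :> R.
  move=> mm; rewrite mulr_gt0 //.
  have [i mi] : exists i, m i != ord0.
    apply/existsP; apply: contraNT mm; rewrite negb_exists => /forallP H.
    by apply/eqP/ffunP => i; rewrite ffunE; apply/eqP; rewrite -[_ == _]negbK.
  rewrite (bigD1 i) //= ltr_pwDl //; last first.
    by apply: sumr_ge0 => j _; rewrite exprn_ge0.
  by rewrite exprn_gt0 // ltr0n lt0n.
have lipS : \sum_(m | m != m0) mode_weight m * L m * mode_coef f m ^+ 2 <= d%:R.
  have nd : 0 < (n%:R ^+ d : R) by rewrite exprn_gt0.
  have H := le_trans (ler_wpM2l (ltW (exprn_gt0 2 nR0)) (energy_bessel f))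
                    (energy_lipschitz f lip).
  have : \sum_(m : freq) mode_weight m * L m * mode_coef f m ^+ 2 <= d%:R.
    rewrite -(ler_pM2l nd) mulrC [X in _ <= X]mulrC; apply: le_trans H.
    rewrite mulr_suml !mulr_sumr; apply: ler_sum => m _; rewrite /L.
    by rewrite le_eqVlt; apply/orP; left; apply/eqP; ring.
  apply: le_trans; rewrite [X in _ <= X](bigD1 m0) //= lerDr.
  rewrite mulr_ge0 ?sqr_ge0 // mulr_ge0 ?(ltW (mode_weight_gt0 _)) //.
  by rewrite mulr_ge0 ?mode_eigen_ge0 // exprn_ge0.
apply: (@le_trans _ _ (2^-1 * (t * (\sum_(m | m != m0)
    mode_weight m * L m * mode_coef f m ^+ 2) + t^-1 * \sum_(m | m != m0)
     mode_weight m * U m ^+ 2 / (8 * \sum_i (m i)%:R ^+ 2)))); last first.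
  by rewrite ler_pM2l ?invr_gt0 // lerD2r ler_pM2l.
rewrite (bigD1 m0) //= U0 mulr0 add0r !mulr_sumr -big_split mulr_sumr /=.
apply: ler_sum => m mm.
set F := mode_coef f m; set s := 8 * _.
have s0 : 0 < s by exact: m2_gt0.
have sL : s <= L m by exact: L8.
have W0 := mode_weight_gt0 m.
have CW : 0 <= (\prod_i kernel_coef T (m i) : R) <= mode_weight m.
  apply/andP; split; first by apply: prodr_ge0 => i _; exact: kernel_coef_ge0.
  by apply: ler_prod => i _; rewrite kernel_coef_ge0 kernel_coef_le.
apply: (@le_trans _ _ (mode_weight m * `|F * U m|)).
  case/andP: CW => C0 C1; rewrite -mulrA.
  apply: (le_trans (ler_norm _)); rewrite normrM (ger0_norm C0).
  by rewrite ler_wpM2r.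
have amgm : `|F * U m| <= 2^-1 * (t * L m * F ^+ 2 + t^-1 * (U m ^+ 2 / s)).
  apply: (@le_trans _ _ (2^-1 * (t * s * F ^+ 2 + t^-1 * (U m ^+ 2 / s)))); last first.
    by rewrite ler_pM2l ?invr_gt0 // lerD2r ler_wpM2r ?sqr_ge0 // ler_pM2l.
  have ts0 : 0 < t * s by rewrite mulr_gt0.
  have -> : t^-1 * (U m ^+ 2 / s) = U m ^+ 2 / (t * s) by field; rewrite !gt_eqF.
  set k := t * s; have k0 : k != 0 by rewrite gt_eqF.
  have H e : e ^+ 2 = 1 ->
      0 <= (k * F - e * U m) ^+ 2 / k -> e * (F * U m) <=
      2^-1 * (k * F ^+ 2 + U m ^+ 2 / k).
    move=> e2; have -> : (k * F - e * U m) ^+ 2 / k =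
      k * F ^+ 2 - 2 * (e * (F * U m)) + e ^+ 2 * U m ^+ 2 / k by field.
    by rewrite e2; lra.
  rewrite ler_norml; apply/andP; split.
    rewrite lerNl -mulN1r; apply: H; first by rewrite sqrrN expr1n.
    by rewrite divr_ge0 ?sqr_ge0 ?ltW.
  rewrite -[F * _]mul1r; apply: H; first by rewrite expr1n.
  by rewrite divr_ge0 ?sqr_ge0 ?ltW.
apply: (le_trans (ler_wpM2l (ltW W0) amgm)).
by rewrite le_eqVlt; apply/orP; left; apply/eqP; ring.
Qed.

End Grid.

(** * From a finite plan to a coupling of measures *)

Section BlockCoupling.
Context {d1 d2 : measure_display} {T1 : measurableType d1}
  {T2 : measurableType d2} {R : realType}.

Lemma fsbig_finType (V : nmodType) (I : finType) (F : I -> V) :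
  (\sum_(i \in [set: I]) F i = \sum_i F i)%R.
Proof.
rewrite [RHS](@bigfs _ _ _ _ _ xpredT) ?index_enum_uniq //.
  by congr (\sum_(i \in _) _)%R; apply/seteqP; split.
by move=> i _; rewrite mem_index_enum.
Qed.

Lemma measure_block_sum {d : measure_display} {T : measurableType d}
    (mu : probability T R) (I : finType) (A : I -> set T) (C : set T) :
  (forall i, measurable (A i)) -> trivIset [set: I] A ->
  mu (\bigcup_i A i) = 1%E -> measurable C ->
  mu C = (\sum_i fine (mu (C `&` A i)))%:E.
Proof.
move=> mA tA muA mC.
have mU : measurable (\bigcup_i A i) by apply: fin_bigcup_measurable.
have muN : mu (~` (\bigcup_i A i)) = 0%E.
  by rewrite probability_setC // muA subee.
have muC0 : mu (C `&` ~` (\bigcup_i A i)) = 0%E.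
  apply: (@subset_measure0 _ _ _ mu _ (~` (\bigcup_i A i))).
  - by apply: measurableI => //; exact: measurableC.
  - exact: measurableC.
  - exact: subIsetr.
  - exact: muN.
have muC : mu C = (mu (C `&` \bigcup_i A i) + mu (C `&` ~` (\bigcup_i A i)))%E.
  rewrite -[in LHS](setIT C) -(setUv (\bigcup_i A i)) setIUr.
  apply: measureU; first exact: measurableI.
    by apply: measurableI => //; exact: measurableC.
  by rewrite setIACA setICr setI0.
have muCA : mu (C `&` \bigcup_i A i) = (\sum_i mu (C `&` A i))%E.
  rewrite setI_bigcupr; have := @measure_fin_bigcup _ _ _ mu I setT (fun i => C `&` A i).
  rewrite (@fsbig_finType (\bar R)); apply; first exact: finite_finset.
    exact: trivIset_setIl.
  by move=> i _; exact: measurableI.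
rewrite muC muC0 adde0 muCA -sumEFin; apply: eq_bigr => i _.
by rewrite fineK // fin_num_measure //; exact: measurableI.
Qed.

(** Given masses [b i j] whose marginals are the masses of two finite
    partitions, spread [b i j] over the block [A i `*` B j] proportionally to
    the product measure. *)
Lemma block_coupling (mu : probability T1 R) (nu : probability T2 R)
    (I J : finType) (A : I -> set T1) (B : J -> set T2) (b : I -> J -> R) :
  (forall i, measurable (A i)) -> trivIset [set: I] A ->
  mu (\bigcup_i A i) = 1%E ->
  (forall j, measurable (B j)) -> trivIset [set: J] B ->
  nu (\bigcup_j B j) = 1%E ->
  (forall i j, 0 <= b i j) ->
  (forall i, \sum_j b i j = fine (mu (A i))) ->
  (forall j, \sum_i b i j = fine (nu (B j))) ->
  exists lambda : probability (T1 * T2)%type R, [/\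
    forall C, measurable C -> lambda (fst @^-1` C) = mu C,
    forall C, measurable C -> lambda (snd @^-1` C) = nu C &
    forall (f : T1 * T2 -> R) (c : I -> J -> R), (forall z, 0 <= f z) ->
      measurable_fun setT f ->
      (forall i j x y, A i x -> B j y -> f (x, y) <= c i j) ->
      (\int[lambda]_z (f z)%:E <= (\sum_i \sum_j c i j * b i j)%:E)%E].
Proof.
move=> mA tA muA mB tB nuB b0 bA bB.
pose p i := fine (mu (A i)); pose q j := fine (nu (B j)).
have p0 i : 0 <= p i by rewrite fine_ge0.
have q0 j : 0 <= q j by rewrite fine_ge0.
have ba_ge0 (u : I * J) : 0 <= b u.1 u.2 / (p u.1 * q u.2).
  by rewrite divr_ge0 // mulr_ge0.
have bp0 i j : p i = 0 -> b i j = 0.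
  move=> pi0; have /eqP : \sum_j b i j = 0 by rewrite bA.
  by rewrite psumr_eq0 // => /allP/(_ j (mem_index_enum _))/eqP.
have bq0 i j : q j = 0 -> b i j = 0.
  move=> qj0; have /eqP : \sum_i b i j = 0 by rewrite bB.
  by rewrite psumr_eq0 // => /allP/(_ i (mem_index_enum _))/eqP.
(* the finite sum of measures over pairs of blocks is enumerated by naturals *)
pose s := index_enum ((I * J)%type : finType).
pose Q (k : nat) : set (T1 * T2) :=
  if ohead (drop k s) is Some u then A u.1 `*` B u.2 else set0.
have mQ k : measurable (Q k).
  by rewrite /Q; case: ohead => // u; exact: measurableX.
pose w (k : nat) : {nonneg R} :=
  if ohead (drop k s) is Some u then NngNum (ba_ge0 u) else NngNum (lexx (0 : R)).
pose m : {measure set (T1 * T2)%type -> \bar R} :=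
  msum (fun k => mscale (w k) (mrestr (mu \x nu)%E (mQ k))) (size s).
have sum_s (F : nat -> \bar R) (F' : I * J -> \bar R) :
    (forall k u, ohead (drop k s) = Some u -> F k = F' u) ->
    (\sum_(k < size s) F k = \sum_i \sum_j F' (i, j))%E.
  move=> FF'; rewrite pair_bigA /=.
  transitivity (\sum_(u <- s) F' u)%E; last by apply: eq_bigr => -[].
  move: {Q mQ w m} s F FF'; elim=> [|u r IH] F FF'.
    by rewrite big_ord0 big_nil.
  rewrite big_ord_recl big_cons (FF' 0 u) //; congr (_ + _)%E.
  by apply: (IH (fun k => F k.+1)) => k v kv; exact: FF'.
have mE C D : measurable C -> measurable D -> m (C `*` D) =
    (\sum_i \sum_j b i j / (p i * q j) *
      (fine (mu (C `&` A i)) * fine (nu (D `&` B j))))%:E.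
  move=> mC mD; transitivity (\sum_i \sum_j (b i j / (p i * q j) *
      (fine (mu (C `&` A i)) * fine (nu (D `&` B j))))%:E)%E; last first.
    by rewrite -sumEFin; apply: eq_bigr => i _; rewrite -sumEFin.
  apply: (sum_s (fun k => mscale (w k) (mrestr (mu \x nu)%E (mQ k)) (C `*` D))
    (fun u => (b u.1 u.2 / (p u.1 * q u.2) *
      (fine (mu (C `&` A u.1)) * fine (nu (D `&` B u.2))))%:E)).
  move=> k u ku; rewrite /mscale /w ku /= /mrestr /Q ku -setXI.
  rewrite product_measure1E; [|exact: measurableI..].
  rewrite [RHS]EFinM; congr (_ * _)%E; rewrite EFinM; congr (_ * _)%E.
    by rewrite fineK // fin_num_measure //; exact: measurableI.
  by rewrite fineK // fin_num_measure //; exact: measurableI.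
have mfst C : measurable C -> m (fst @^-1` C) = mu C.
  move=> mC; have -> : fst @^-1` C = C `*` [set: T2].
    by apply/seteqP; split => -[x y] //= [].
  rewrite mE // (measure_block_sum _ _ _ _ mA tA muA mC); congr (_%:E).
  apply: eq_bigr => i _.
  have [pi0|pi0] := eqVneq (p i) 0.
    rewrite big1 => [|j _]; last by rewrite bp0 // !mul0r.
    have -> : mu (C `&` A i) = 0%E; last by [].
    apply: (@subset_measure0 _ _ _ mu _ (A i)) => //.
      exact: measurableI.
    by rewrite -[LHS]fineK ?fin_num_measure // -/(p i) pi0.
  transitivity (\sum_j b i j / p i * fine (mu (C `&` A i))).
    apply: eq_bigr => j _; rewrite setTI -/(q j).
    have [qj0|qj0] := eqVneq (q j) 0; first by rewrite bq0 // !mul0r.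
    by field; rewrite pi0.
  by rewrite -!mulr_suml bA -/(p i) divff // mul1r.
have msnd D : measurable D -> m (snd @^-1` D) = nu D.
  move=> mD; have -> : snd @^-1` D = [set: T1] `*` D.
    by apply/seteqP; split => -[x y] //= [].
  rewrite mE // (measure_block_sum _ _ _ _ mB tB nuB mD); congr (_%:E).
  rewrite exchange_big; apply: eq_bigr => j _ /=.
  have [qj0|qj0] := eqVneq (q j) 0.
    rewrite big1 => [|i _]; last by rewrite bq0 // !mul0r.
    have -> : nu (D `&` B j) = 0%E; last by [].
    apply: (@subset_measure0 _ _ _ nu _ (B j)) => //.
      exact: measurableI.
    by rewrite -[LHS]fineK ?fin_num_measure // -/(q j) qj0.
  transitivity (\sum_i b i j / q j * fine (nu (D `&` B j))).
    apply: eq_bigr => i _; rewrite setTI -/(p i).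
    have [pi0|pi0] := eqVneq (p i) 0; first by rewrite bp0 // !mul0r.
    by field; rewrite pi0 qj0.
  by rewrite -!mulr_suml bB -/(q j) divff // mul1r.
have mT : m setT = 1%E.
  by have := mfst _ measurableT; rewrite preimage_setT probability_setT.
(* the total mass is already 1; normalizing packs m as a probability *)
pose lambda : probability (T1 * T2)%type R :=
  mnormalize m (dirac (point : T1 * T2)).
have lambdaE C : lambda C = m C.
  by rewrite /lambda /= /mnormalize mT onee_eq0 /= invr1 mule1.
exists lambda; split.
- by move=> C mC; exact: etrans (lambdaE _) (mfst _ mC).
- by move=> C mC; exact: etrans (lambdaE _) (msnd _ mC).
move=> f c f0 mf fc.
have mfE : measurable_fun [set: (T1 * T2)%type] (fun z => (f z)%:E : \bar R).
  exact/measurable_EFinP.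
rewrite (eq_measure_integral m) => [|C _ _]; last exact: lambdaE.
rewrite ge0_integral_measure_sum //; last by move=> z _; rewrite lee_fin.
apply: (@le_trans _ _ (\sum_(k < size s)
  (if ohead (drop k s) is Some u then (c u.1 u.2 * b u.1 u.2)%:E else 0))%E); last first.
  rewrite le_eqVlt; apply/orP; left; apply/eqP.
  transitivity (\sum_i \sum_j (c i j * b i j)%:E)%E; last first.
    by rewrite -sumEFin; apply: eq_bigr => i _; rewrite sumEFin.
  apply: (sum_s (fun k => if ohead (drop k s) is Some u
    then (c u.1 u.2 * b u.1 u.2)%:E else 0%E)
    (fun u => (c u.1 u.2 * b u.1 u.2)%:E)).
  by move=> k u ->.
apply: lee_sum => k _.
rewrite ge0_integral_mscale //; last by move=> z _; rewrite lee_fin.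
rewrite /w; case ku: (ohead (drop k s)) => [u|]; last by rewrite mul0e.
have [pq0|pq0] := eqVneq (p u.1 * q u.2) 0.
  have bu0 : b u.1 u.2 = 0.
    by move/eqP: pq0; rewrite mulf_eq0 => /orP[] /eqP; [exact: bp0|exact: bq0].
  by rewrite [(NngNum _)%:num]/= {1}bu0 mul0r mul0e bu0 mulr0.
have Qk : Q k = A u.1 `*` B u.2 by rewrite /Q ku.
have muQ : (mu \x nu)%E (Q k) = (p u.1 * q u.2)%:E.
  rewrite Qk product_measure1E // EFinM.
  by congr (_ * _)%E; rewrite fineK // fin_num_measure.
rewrite (@ge0_negligible_integral _ _ _ _ setT (~` Q k)) //; last 3 first.
- exact: measurableC.
- by move=> z _; rewrite lee_fin.
- by rewrite /= /mrestr setICl measure0.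
rewrite setTD setCK.
apply: (@le_trans _ _ ((b u.1 u.2 / (p u.1 * q u.2))%:E *
   (c u.1 u.2 * (p u.1 * q u.2))%:E)%E).
  apply: lee_wpmul2l; first by rewrite lee_fin.
  apply: (@le_trans _ _ (\int[mrestr (mu \x nu)%E (mQ k)]_(z in Q k)
      (c u.1 u.2)%:E)%E).
    apply: ge0_le_integral => //.
    - by move=> z _; rewrite lee_fin.
    - exact: measurable_funS mfE.
    - by move=> [x y]; rewrite Qk lee_fin => -[/= Ax By]; exact: fc.
  by rewrite integral_cst // /= /mrestr setIid muQ -EFinM.
rewrite -EFinM lee_fin le_eqVlt; apply/orP; left; apply/eqP; field.
by move: pq0; rewrite mulf_eq0 negb_or => /andP[-> ->].
Qed.

End BlockCoupling.

(** * Means of bounded measurable functions *)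

Section BoundedMeasurable.
Context {d : measure_display} {T : measurableType d} {R : realType}.
Implicit Types (mu : probability T R) (F G : T -> R).

Definition bounded_measurable F : Prop :=
  measurable_fun [set: T] F /\ exists M, forall x, `|F x| <= M.

Lemma bounded_measurable_integrable mu F : bounded_measurable F ->
  mu.-integrable [set: T] (EFin \o F).
Proof.
move=> [mF [M FM]].
have muT : (mu [set: T] < +oo)%E by rewrite probability_setT ltry.
apply: measurable_bounded_integrable => //.
exists M; split; first exact: num_real.
by move=> N MN x _ /=; exact: le_trans (FM x) (ltW MN).
Qed.

Lemma bounded_measurable_cst (c : R) : bounded_measurable (fun=> c).
Proof. by split; [exact: measurable_cst|exists `|c|]. Qed.

Lemma bounded_measurableD F G : bounded_measurable F -> bounded_measurable G ->
  bounded_measurable (fun x => F x + G x).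
Proof.
move=> [mF [M FM]] [mG [N GN]]; split; first exact: measurable_funD.
by exists (M + N) => x; rewrite (le_trans (ler_normD _ _)) // lerD.
Qed.

Lemma bounded_measurableM F G : bounded_measurable F -> bounded_measurable G ->
  bounded_measurable (fun x => F x * G x).
Proof.
move=> [mF [M FM]] [mG [N GN]]; split; first exact: measurable_funM.
by exists (M * N) => x; rewrite normrM ler_pM.
Qed.

Lemma bounded_measurableZ (c : R) F : bounded_measurable F ->
  bounded_measurable (fun x => c * F x).
Proof. exact/bounded_measurableM/bounded_measurable_cst. Qed.

Lemma bounded_measurableB F G : bounded_measurable F -> bounded_measurable G ->
  bounded_measurable (fun x => F x - G x).
Proof.
move=> bF bG; under eq_fun do rewrite -[- G _]mulN1r.
by apply: bounded_measurableD => //; exact: bounded_measurableZ.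
Qed.

Lemma bounded_measurable_sum (I : Type) (s : seq I) (F : I -> T -> R) :
  (forall i, bounded_measurable (F i)) ->
  bounded_measurable (fun x => \sum_(i <- s) F i x).
Proof.
move=> bF; elim: s => [|i s IH].
  by under eq_fun do rewrite big_nil; exact: bounded_measurable_cst.
by under eq_fun do rewrite big_cons; exact: bounded_measurableD.
Qed.

Lemma bounded_measurable_prod (I : Type) (s : seq I) (F : I -> T -> R) :
  (forall i, bounded_measurable (F i)) ->
  bounded_measurable (fun x => \prod_(i <- s) F i x).
Proof.
move=> bF; elim: s => [|i s IH].
  by under eq_fun do rewrite big_nil; exact: bounded_measurable_cst.
by under eq_fun do rewrite big_cons; exact: bounded_measurableM.
Qed.

Lemma bounded_measurable_indic (A : set T) : measurable A ->
  bounded_measurable (\1_A : T -> R).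
Proof.
move=> mA; split; first exact: measurable_indic.
by exists 1 => x; rewrite indicE; case: (x \in A); rewrite ?normr1 ?normr0.
Qed.

Lemma bounded_measurable_cos (F : T -> R) : measurable_fun [set: T] F ->
  bounded_measurable (fun x => cos (F x)).
Proof.
move=> mF; split; last by exists 1 => x; exact: cos_max.
have mcos : measurable_fun [set: R] (@cos R).
  by apply: continuous_measurable_fun; exact: continuous_cos.
exact: measurableT_comp mcos mF.
Qed.

Lemma bounded_measurable_sin (F : T -> R) : measurable_fun [set: T] F ->
  bounded_measurable (fun x => sin (F x)).
Proof.
move=> mF; split; last by exists 1 => x; exact: sin_max.
have msin : measurable_fun [set: R] (@sin R).
  by apply: continuous_measurable_fun; exact: continuous_sin.
exact: measurableT_comp msin mF.
Qed.

Definition mean mu F : R := Rintegral mu [set: T] F.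

Lemma mean_sum mu (I : Type) (s : seq I) (c : I -> R) (F : I -> T -> R) :
  (forall i, bounded_measurable (F i)) ->
  mean mu (fun x => \sum_(i <- s) c i * F i x) = \sum_(i <- s) c i * mean mu (F i).
Proof.
move=> bF; rewrite /mean; elim: s => [|i s IH].
  rewrite big_nil; under eq_Rintegral do rewrite big_nil.
  by rewrite Rintegral_cst // mul0r.
rewrite big_cons -IH; under eq_Rintegral do rewrite big_cons.
rewrite RintegralD //.
- by rewrite RintegralZl //; exact: bounded_measurable_integrable.
- by apply: bounded_measurable_integrable; exact: bounded_measurableZ.
- apply: bounded_measurable_integrable; apply: bounded_measurable_sum => j.
  exact: bounded_measurableZ.
Qed.

Lemma meanB mu F G : bounded_measurable F -> bounded_measurable G ->
  mean mu (fun x => F x - G x) = mean mu F - mean mu G.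
Proof.
by move=> bF bG; rewrite /mean RintegralB //; exact: bounded_measurable_integrable.
Qed.

Lemma mean_indic mu (A : set T) : measurable A -> mean mu \1_A = fine (mu A).
Proof. by move=> mA; rewrite /mean /Rintegral integral_indic // setIT. Qed.

Lemma mean_norm_le mu F (D : set T) (e : R) : bounded_measurable F ->
  measurable D -> mu D = 1%E -> (forall x, D x -> `|F x| <= e) ->
  `|mean mu F| <= e.
Proof.
move=> bF mD muD Fe.
have iF := bounded_measurable_integrable mu F bF.
have muDC : mu (~` D) = 0%E by rewrite probability_setC // muD subee.
rewrite /mean /Rintegral (negligible_integral _ _ iF muDC) //; last exact: measurableC.
rewrite setTD setCK -/(Rintegral mu D F).
have iFD : mu.-integrable D (EFin \o F) by exact: integrableS iF.
apply: (le_trans (le_normr_Rintegral mD iFD)).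
have -> : e = Rintegral mu D (fun=> e).
  by rewrite Rintegral_cst // -[RHS]/(e * fine (mu D)) muD mulr1.
apply: le_Rintegral => //.
  have := integrable_abse iFD.
  by congr (integrable _ _ _); apply/funext => x /=.
by apply: finite_measure_integrable_cst.
Qed.

End BoundedMeasurable.

(** * The cells of the cube *)

Section Cells.
Context {R : realType} (d n : nat).
Hypothesis n_gt0 : (0 < n)%N.

Local Notation grid := {ffun 'I_d -> 'I_n}.

Let nR0 : 0 < (n%:R : R). Proof. by rewrite ltr0n. Qed.

Lemma measurable_cube : measurable (@cube R d).
Proof.
have -> : @cube R d = \bigcap_(i in [set: 'I_d]) ((@tnth d R)^~ i @^-1` `[0, 1]%classic).
  apply/seteqP; split=> x /= H.
    by move=> i _ /=; rewrite in_itv /=; exact: H.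
  by move=> i; have := H i Logic.I; rewrite /= in_itv.
apply: fin_bigcap_measurable => [|i _]; first exact: finite_finset.
rewrite -[X in measurable X]setTI; exact: measurable_tnth.
Qed.

(** Truncation at [n.-1] puts the endpoint 1 in the last cell, so that the cells
    cover the cube. *)
Definition slot (t : R) : nat := minn (Num.truncn (n%:R * t)) n.-1.

Lemma slot_lt t : (slot t < n)%N.
Proof. by rewrite /slot gtn_min prednK ?leqnn ?orbT // ltn_predL n_gt0 orbT. Qed.

Lemma measurable_slot_ge (k : nat) : measurable [set t | (k <= slot t)%N].
Proof.
have [->|k0] := posnP k.
  by rewrite (_ : mkset _ = setT) //; apply/seteqP.
have [kn|kn] := leqP k n.-1; last first.
  rewrite (_ : mkset _ = set0) //; apply/seteqP; split => // t /=.
  by rewrite /slot leq_min => /andP[_]; rewrite leqNgt kn.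
rewrite (_ : mkset _ = `[k%:R / n%:R, +oo[%classic); first exact: measurable_itv.
apply/seteqP; split => t /=; rewrite /slot leq_min kn andbT in_itv /= andbT;
  by rewrite -[k]prednK // Num.Theory.truncn_gt_nat ler_pdivrMr // mulrC.
Qed.

Lemma measurable_slot (k : nat) : measurable [set t | slot t = k].
Proof.
rewrite (_ : mkset _ = [set t | (k <= slot t)%N] `\` [set t | (k.+1 <= slot t)%N]).
  by apply: measurableD; exact: measurable_slot_ge.
apply/seteqP; split => t /=.
  by move=> ->; rewrite leqnn ltnn.
by move=> [kt /negP]; rewrite -leqNgt => tk; apply/eqP; rewrite eqn_leq kt tk.
Qed.

Lemma slot_near t : 0 <= t <= 1 -> `|node n (slot t) - t| <= n%:R^-1.
Proof.
move=> /andP[t0 t1].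
have nt0 : 0 <= n%:R * t by rewrite mulr_ge0 ?ler0n.
have lo : (slot t)%:R <= n%:R * t.
  apply: (@le_trans _ _ (Num.truncn (n%:R * t))%:R).
    by rewrite ler_nat geq_minl.
  by rewrite Num.Theory.truncn_le.
have hi : n%:R * t <= (slot t)%:R + 1.
  rewrite /slot; have [_|_] :=
    leqP (Num.truncn (n%:R * t)) n.-1.
    by rewrite natr1; have /andP[_ /ltW] := Num.Theory.truncn_itv nt0.
  by rewrite natr1 prednK // ler_piMr ?ler0n.
have -> : node n (slot t) - t = ((slot t)%:R + 2^-1 - n%:R * t) / n%:R.
  by rewrite /node; field; rewrite gt_eqF.
rewrite normrM [X in _ * X]ger0_norm ?invr_ge0 ?ler0n //.
rewrite ler_pdivrMr // mulVf ?gt_eqF // ler_norml; lra.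
Qed.

Definition cell (y : grid) : set (d.-tuple R) :=
  @cube R d `&` [set x | forall i, slot (tnth x i) = y i].

Lemma measurable_cell y : measurable (cell y).
Proof.
apply: measurableI; first exact: measurable_cube.
have -> : [set x : d.-tuple R | forall i, slot (tnth x i) = y i] =
    \bigcap_(i in [set: 'I_d]) ((@tnth d R)^~ i @^-1` [set t | slot t = y i]).
  by apply/seteqP; split=> x /= H i; [move=> _|]; apply: H.
apply: fin_bigcap_measurable => [|i _]; first exact: finite_finset.
rewrite -[X in measurable X]setTI; apply: measurable_tnth => //.
exact: measurable_slot.
Qed.

Lemma trivIset_cell : trivIset [set: grid] cell.
Proof.
move=> y y' _ _ [x [[_ xy] [_ xy']]]; apply/ffunP => i; apply/val_inj.
by rewrite /= -xy -xy'.
Qed.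

Lemma bigcup_cell : \bigcup_y cell y = @cube R d.
Proof.
apply/seteqP; split=> x; first by case=> y _ [].
move=> cx; exists [ffun i => Ordinal (slot_lt (tnth x i))] => //; split=> // i.
by rewrite ffunE.
Qed.

Lemma cell_near y x : cell y x ->
  norm2 (fun i => grid_point (R := R) d n y i - tnth x i) <= Num.sqrt d%:R / n%:R.
Proof.
move=> [cx xy]; rewrite -[in X in _ <= X](card_ord d).
apply: norm2_le; first by rewrite invr_ge0 ler0n.
by move=> i; rewrite /grid_point -xy; exact/slot_near/cx.
Qed.

End Cells.

(** * The Wasserstein distance and the cosine modes *)

Section WassersteinGrid.
Context {R : realType} (d : nat).
Implicit Types mu nu : probability (d.-tuple R) R.

Lemma measurable_eucl_dist : measurable_fun [set: (d.-tuple R * d.-tuple R)%type]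
  (fun z => eucl_dist z.1 z.2 : R).
Proof.
have msqrt : measurable_fun [set: R] (@Num.sqrt R).
  by apply: continuous_measurable_fun; exact: sqrt_continuous.
apply: (measurableT_comp msqrt); apply: measurable_sum => i.
apply: measurable_funX; apply: measurable_funB.
  exact: (measurableT_comp (measurable_tnth i) measurable_fst).
exact: (measurableT_comp (measurable_tnth i) measurable_snd).
Qed.

(** Transport between cells costs the distance of their centres, up to the two
    distances to the centres. *)
Lemma W1_le_grid mu nu (n : nat) (k : R) : (0 < n)%N -> 0 < k ->
  mu (@cube R d) = 1%E -> nu (@cube R d) = 1%E ->
  exists2 f : {ffun 'I_d -> 'I_n} -> R,
    forall y y', f y - f y' <= grid_dist d n y y' &
    (W1 mu nu <= (\sum_y f y * (fine (mu (cell d n y)) - fine (nu (cell d n y)))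
      + k + 2 * (Num.sqrt d%:R / n%:R))%:E)%E.
Proof.
move=> n0 k0 muc nuc.
pose p y := fine (mu (cell d n y)); pose q y := fine (nu (cell d n y)).
have mC := @measurable_cell R d n n0; have tC := trivIset_cell (R := R) d n.
have muU : mu (\bigcup_y cell d n y) = 1%E by rewrite bigcup_cell.
have nuU : nu (\bigcup_y cell d n y) = 1%E by rewrite bigcup_cell.
have p0 y : 0 <= p y by rewrite fine_ge0.
have q0 y : 0 <= q y by rewrite fine_ge0.
have sum1 (la : probability (d.-tuple R) R) : la (\bigcup_y cell d n y) = 1%E ->
    \sum_y fine (la (cell d n y)) = 1.
  move=> laU; have := measure_block_sum la _ _ _ mC tC laU measurableT.
  rewrite probability_setT => -[E]; rewrite [RHS]E.
  by apply: eq_bigr => y _; rewrite setTI.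
pose M : R := \sum_(u : {ffun 'I_d -> 'I_n} * {ffun 'I_d -> 'I_n})
  grid_dist d n u.1 u.2.
have cM y y' : 0 <= (grid_dist d n y y' : R) <= M.
  rewrite norm2_ge0 /= /M (bigD1 (y, y')) //= lerDl sumr_ge0 // => u _.
  exact: norm2_ge0.
have [b [f [b0 bp bq flip bcost]]] := kantorovich_finite (grid_dist d n) p q M k cM
  (grid_dist_refl d n) (grid_dist_triangle d n) p0 q0 (sum1 _ muU) (sum1 _ nuU) k0.
exists f => //.
have [la [la1 la2 lacost]] :=
  block_coupling mu nu _ _ _ _ b mC tC muU mC tC nuU b0 bp bq.
apply: (@le_trans _ _ (\int[la]_z (eucl_dist z.1 z.2)%:E)%E).
  apply: ereal_inf_lbound; exists la => // A mA; split; [exact: la1|exact: la2].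
apply: le_trans (lacost (fun z => eucl_dist z.1 z.2)
  (fun y y' => grid_dist d n y y' + 2 * (Num.sqrt d%:R / n%:R)) _
  measurable_eucl_dist _) _.
- by move=> z; exact: sqrtr_ge0.
- move=> y y' x x' Cx Cx' /=.
  have Nx := cell_near d n n0 y x Cx; have Nx' := cell_near d n n0 y' x' Cx'.
  have -> : eucl_dist x x' = norm2 (fun i : 'I_d =>
    ((tnth x i - grid_point d n y i) + (grid_point d n y i - grid_point d n y' i))
    + (grid_point d n y' i - tnth x' i)).
    rewrite /eucl_dist /norm2; congr Num.sqrt; apply: eq_bigr => i _.
    by congr (_ ^+ 2); ring.
  apply: (le_trans (ler_norm2D _ _)); rewrite mulr2n mulrDl mul1r addrA.
  apply: lerD => //; apply: (le_trans (ler_norm2D _ _)).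
  rewrite addrC lerD //; apply: le_trans Nx.
  rewrite /norm2 ler_wsqrtr //; apply: ler_sum => i _.
  by rewrite -sqrrN opprB.
rewrite lee_fin.
have -> : \sum_y \sum_y' (grid_dist d n y y' + 2 * (Num.sqrt d%:R / n%:R)) * b y y' =
    total_cost (grid_dist d n) b + 2 * (Num.sqrt d%:R / n%:R).
  have E : \sum_y \sum_y' 2 * (Num.sqrt d%:R / n%:R) * b y y' =
      2 * (Num.sqrt d%:R / n%:R).
    under eq_bigr => y _ do rewrite -mulr_sumr -/(row_mass b y) bp.
    by rewrite -mulr_sumr (sum1 _ muU) mulr1.
  rewrite -[X in _ = _ + X]E.
  rewrite /total_cost -big_split; apply: eq_bigr => y _ /=.
  by rewrite -big_split; apply: eq_bigr => y' _ /=; rewrite mulrDl.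
by rewrite lerD2r.
Qed.

Lemma bounded_measurable_mode (T : nat) (m : {ffun 'I_d -> 'I_T.+1}) :
  bounded_measurable (fun x : d.-tuple R => mode d T m (tnth x)).
Proof.
apply: bounded_measurable_prod => i; apply: bounded_measurable_cos.
apply: measurable_funM; first exact: measurable_cst.
exact: measurable_tnth.
Qed.

(** The integral of the dual function against [mu - nu] differs from that of its
    smoothing by two smoothing errors, whence [16 / 5 = 2 * (8 / 5)]. All errors
    that depend on the mesh vanish for fine grids and are absorbed in [k]. *)
Lemma W1_le_modes mu nu (T : nat) (k t : R) : (0 < d)%N -> 0 < k -> 0 < t ->
  mu (@cube R d) = 1%E -> nu (@cube R d) = 1%E ->
  (W1 mu nu <= (k + 16 / 5 * Num.sqrt d%:R / T.+2%:R +
    2^-1 * (t * d%:R + t^-1 * \sum_(m : {ffun 'I_d -> 'I_T.+1} | m != [ffun=> ord0])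
      mode_weight d T m *
      (mean mu (fun x => mode d T m (tnth x)) -
       mean nu (fun x => mode d T m (tnth x))) ^+ 2 /
      (8 * \sum_i (m i)%:R ^+ 2)))%:E)%E.
Proof.
move=> d0 k0 t0 muc nuc.
have sd0 : 0 < Num.sqrt (d%:R : R) by rewrite sqrtr_gt0 ltr0n.
(* T + T keeps the frequencies in the range where the discrete eigenvalues are
   comparable to the squared frequencies *)
pose n := ((Num.truncn (8 * Num.sqrt d%:R / k)).+1 + (T + T))%N.
have n0 : (0 < n)%N by [].
have Tn : (T < n)%N by rewrite /n; lia.
have TTn : (T + T <= n)%N by rewrite leq_addl.
have nR0 : 0 < (n%:R : R) by rewrite ltr0n.
have small : 4 * (Num.sqrt d%:R / n%:R) <= 2^-1 * k.
  have : 8 * Num.sqrt d%:R / k <= n%:R.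
    apply/ltW; apply: (lt_le_trans (Num.Theory.truncnS_gt _)).
    by rewrite ler_nat leq_addr.
  rewrite ler_pdivrMr // mulrA ler_pdivrMr //; lra.
have k2 : 0 < 2^-1 * k by rewrite mulr_gt0 ?invr_gt0.
have [f flip W1f] := W1_le_grid mu nu n _ n0 k2 muc nuc.
apply: (le_trans W1f); rewrite lee_fin.
pose F (x : d.-tuple R) := smoothed d n T f (tnth x).
pose S (x : d.-tuple R) : R := \sum_y f y * \1_(cell d n y) x.
pose e : R := Num.sqrt d%:R / n%:R + Num.sqrt d%:R * (8 / 5) / T.+2%:R.
have FE : F = (fun x => \sum_(m : {ffun 'I_d -> 'I_T.+1})
    ((\prod_i kernel_coef T (m i)) * mode_coef d n T f m) * mode d T m (tnth x)).
  by apply/funext => x; rewrite /F smoothed_expansion.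
have bF : bounded_measurable F.
  rewrite FE; apply: bounded_measurable_sum => m.
  exact/bounded_measurableZ/bounded_measurable_mode.
have b1 y : bounded_measurable (\1_(cell d n y) : d.-tuple R -> R).
  by apply: bounded_measurable_indic; apply: measurable_cell.
have bS : bounded_measurable S.
  by apply: bounded_measurable_sum => y; exact: bounded_measurableZ.
have near x : @cube R d x -> `|S x - F x| <= e.
  rewrite -(bigcup_cell d n n0) => -[y _ xy].
  have -> : S x = f y.
    rewrite /S (bigD1 y) //= indicE mem_set // mulr1 big1 ?addr0 // => y' yy'.
    rewrite indicE memNset ?mulr0 // => xy'.
    move/eqP: yy'; apply; apply: (trivIset_cell d n y' y) => //.
    by exists x.
  apply: (smoothed_near d n T n0 Tn f (tnth x) y) => //.
    by case: xy.
  exact: cell_near.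
have meanS (la : probability (d.-tuple R) R) :
    mean la S = \sum_y f y * fine (la (cell d n y)).
  rewrite /S mean_sum //; apply: eq_bigr => y _; rewrite mean_indic //.
  exact: measurable_cell.
have meanF (la : probability (d.-tuple R) R) : mean la F = \sum_(m : {ffun 'I_d -> 'I_T.+1})
    ((\prod_i kernel_coef T (m i)) * mode_coef d n T f m) *
    mean la (fun x => mode d T m (tnth x)).
  by rewrite FE mean_sum // => m; exact: bounded_measurable_mode.
have err (la : probability (d.-tuple R) R) : la (@cube R d) = 1%E ->
    `|mean la S - mean la F| <= e.
  move=> lac; rewrite -meanB //.
  apply: (mean_norm_le la _ (@cube R d)) => //; last exact: measurable_cube.
  exact: bounded_measurableB.
pose U (m : {ffun 'I_d -> 'I_T.+1}) : R := mean mu (fun x => mode d T m (tnth x)) -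
   mean nu (fun x => mode d T m (tnth x)).
have U0 : U [ffun=> ord0] = 0.
  have mode0 x : mode d T [ffun=> ord0] (tnth x) = 1 :> R.
    by rewrite /mode big1 // => i _; rewrite ffunE mulr0 mul0r cos0.
  rewrite /U /mean; under eq_Rintegral do rewrite mode0.
  under [X in _ - X]eq_Rintegral do rewrite mode0.
  rewrite !Rintegral_cst // !mul1r.
  by rewrite -[X in fine X - _]/(mu setT) -[X in _ - fine X]/(nu setT)
             !probability_setT subrr.
have dual := smoothed_dual_bound d n T n0 Tn f U t TTn t0 flip U0.
have dualE : mean mu F - mean nu F = \sum_(m : {ffun 'I_d -> 'I_T.+1})
    (\prod_i kernel_coef T (m i)) * mode_coef d n T f m * U m.
  by rewrite !meanF -sumrB; apply: eq_bigr => m _; rewrite -mulrBr.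
have -> : \sum_y f y * (fine (mu (cell d n y)) - fine (nu (cell d n y))) =
    mean mu S - mean nu S.
  by rewrite !meanS -sumrB; apply: eq_bigr => y _; rewrite mulrBr.
have := err mu muc; have := err nu nuc; rewrite !ler_norml => /andP[n1 n2] /andP[m1 m2].
rewrite -dualE in dual.
have eE : e + e = 2 * (Num.sqrt d%:R / n%:R) + 16 / 5 * Num.sqrt d%:R / T.+2%:R.
  by rewrite /e; field; rewrite !gt_eqF // ltr0n.
apply: (@le_trans _ _ (k + 16 / 5 * Num.sqrt d%:R / T.+2%:R +
  (mean mu F - mean nu F))).
  move: small eE n1 n2 m1 m2; set A := Num.sqrt d%:R / n%:R.
  set B := 16 / 5 * Num.sqrt d%:R / T.+2%:R.
  move: (mean mu S) (mean nu S) (mean mu F) (mean nu F) A B.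
  clear -k k0; move: e => *; lra.
by rewrite lerD2l; exact: dual.
Qed.

End WassersteinGrid.

(** * Cosine modes and characteristic functions *)

Section CharacteristicModes.
Context {R : realType} (d : nat).

Lemma expiD (a b : R) : expi (a + b) = expi a * expi b.
Proof.
apply/eqP; rewrite /expi eq_complex /= cosD sinD.
by rewrite eqxx /= addrC eqxx.
Qed.

Lemma expi_sum (I : Type) (s : seq I) (a : I -> R) :
  expi (\sum_(i <- s) a i) = \prod_(i <- s) expi (a i).
Proof.
elim: s => [|i s IH]; last by rewrite !big_cons expiD IH.
by rewrite !big_nil /expi cos0 sin0.
Qed.

Definition flip_signs {T : nat} (m : {ffun 'I_d -> 'I_T.+1})
    (s : {ffun 'I_d -> bool}) : d.-tuple int :=
  [tuple (if s i then - (m i)%:Z else (m i)%:Z) | i < d].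

(** Real part of the expansion of the product of [exp (i a) + exp (- i a)]. *)
Lemma prod_cos_signs (a : 'I_d -> R) :
  \prod_i cos (a i) = 2 ^- d * \sum_(s : {ffun 'I_d -> bool})
    cos (\sum_i (if s i then - a i else a i)).
Proof.
have E : \prod_i (2 * cos (a i)) = \sum_(s : {ffun 'I_d -> bool})
    cos (\sum_i (if s i then - a i else a i)).
  have H : ((\prod_i (2 * cos (a i)))%:C)%C = \sum_(s : {ffun 'I_d -> bool})
      expi (\sum_i (if s i then - a i else a i)).
    rewrite rmorph_prod /=.
    rewrite (eq_bigr (fun i => \sum_(b : bool) expi (if b then - a i else a i))).
      rewrite bigA_distr_bigA; apply: eq_bigr => s _.
      by rewrite expi_sum.
    move=> i _; rewrite big_bool /= /expi cosN sinN.
    by apply/eqP; rewrite eq_complex /= addNr eqxx andbT; apply/eqP; ring.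
  have := congr1 (@complex.Re R) H; rewrite /= => ->.
  by rewrite raddf_sum.
rewrite -E big_split /= prodr_const card_ord mulrA mulVf ?mul1r //.
Qed.

Lemma mode_cos_inner T (m : {ffun 'I_d -> 'I_T.+1}) (x : d.-tuple R) :
  mode d T m (tnth x) = \sum_(s : {ffun 'I_d -> bool})
    2 ^- d * cos (inner (pi_lattice R (flip_signs m s)) x).
Proof.
rewrite /mode prod_cos_signs mulr_sumr; apply: eq_bigr => s _.
congr (_ * cos _); apply: eq_bigr => i _.
rewrite tnth_mktuple tnth_mktuple; case: (s i) => //.
by rewrite intrN mulrN mulNr.
Qed.

Lemma measurable_inner (xi : d.-tuple R) : measurable_fun [set: d.-tuple R] (inner xi).
Proof.
apply: measurable_sum => i; apply: measurable_funM; first exact: measurable_cst.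
exact: measurable_tnth.
Qed.

Lemma sqr_mean_le (I : finType) (w r : I -> R) : (forall i, 0 <= w i) ->
  \sum_i w i = 1 -> (\sum_i w i * r i) ^+ 2 <= \sum_i w i * r i ^+ 2.
Proof.
move=> w0 w1; set u := \sum_i w i * r i.
have : 0 <= \sum_i w i * (r i - u) ^+ 2.
  by apply: sumr_ge0 => i _; rewrite mulr_ge0 ?sqr_ge0.
have -> : \sum_i w i * (r i - u) ^+ 2 = \sum_i w i * r i ^+ 2 - u ^+ 2.
  transitivity (\sum_i (w i * r i ^+ 2 - 2 * u * (w i * r i) + u ^+ 2 * w i)).
    by apply: eq_bigr => i _; ring.
  by rewrite big_split /= sumrB -!mulr_sumr w1 -/u; ring.
by rewrite subr_ge0.
Qed.

Definition char_gap (mu nu : probability (d.-tuple R) R) (m : d.-tuple int) : R :=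
  ComplexField.Normc.normc
    (char_fun mu (pi_lattice R m) - char_fun nu (pi_lattice R m)) ^+ 2.

Lemma char_gapE mu nu m : char_gap mu nu m =
  (mean mu (fun x => cos (inner (pi_lattice R m) x)) -
   mean nu (fun x => cos (inner (pi_lattice R m) x))) ^+ 2 +
  (mean mu (fun x => sin (inner (pi_lattice R m) x)) -
   mean nu (fun x => sin (inner (pi_lattice R m) x))) ^+ 2.
Proof.
rewrite /char_gap /char_fun /complex_integral /=.
by rewrite sqr_sqrtr // addr_ge0 ?sqr_ge0.
Qed.

Lemma char_gap_ge0 mu nu m : 0 <= char_gap mu nu m.
Proof. exact: sqr_ge0. Qed.

(** A cosine mode is the average of [cos] of the lattice frequencies with all
    choices of signs; the square of an average is at most the average of the
    squares. *)
Lemma mode_gap_le mu nu T (m : {ffun 'I_d -> 'I_T.+1}) :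
  (mean mu (fun x => mode d T m (tnth x)) -
   mean nu (fun x => mode d T m (tnth x))) ^+ 2 <=
  \sum_(s : {ffun 'I_d -> bool}) 2 ^- d * char_gap mu nu (flip_signs m s).
Proof.
have bc s : bounded_measurable
    (fun x : d.-tuple R => cos (inner (pi_lattice R (flip_signs m s)) x)).
  by apply: bounded_measurable_cos; exact: measurable_inner.
have mE la : mean la (fun x => mode d T m (tnth x)) =
    \sum_(s : {ffun 'I_d -> bool}) 2 ^- d *
      mean la (fun x => cos (inner (pi_lattice R (flip_signs m s)) x)).
  by rewrite -mean_sum //; congr mean; apply/funext => x; exact: mode_cos_inner.
rewrite !mE -sumrB.
under eq_bigr do rewrite -mulrBr.
apply: (le_trans (sqr_mean_le _ _ _ _ _)).
- by move=> _; rewrite invr_ge0 exprn_ge0.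
- rewrite sumr_const card_ffun card_bool card_ord -[_ *+ _]mulr_natl natrX.
  by rewrite mulfV // expf_neq0.
apply: ler_sum => s _; rewrite ler_wpM2l ?invr_ge0 ?exprn_ge0 //.
by rewrite char_gapE lerDl sqr_ge0.
Qed.

End CharacteristicModes.

Section LowerIntegral.
Context {disp : measure_display} {T : measurableType disp} {R : realType}
  (mu : {measure set T -> \bar R}).

(** [W1] is not known to be measurable in its arguments. The integral of a
    nonnegative function is by definition the supremum over the simple functions
    below it, hence monotone for all functions. *)
Lemma ge0_le_integral_nonmeasurable (f g : T -> \bar R) :
  (forall x, 0 <= f x)%E -> (forall x, f x <= g x)%E ->
  (\int[mu]_x f x <= \int[mu]_x g x)%E.
Proof.
move=> f0 fg; have g0 x : (0 <= g x)%E := le_trans (f0 x) (fg x).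
rewrite !ge0_integralTE //; apply: le_ereal_sup => _ [h hf <-].
by exists h => // x; exact: le_trans (hf x) (fg x).
Qed.

End LowerIntegral.

Lemma W1_ge0 {R : realType} (d : nat) (mu nu : probability (d.-tuple R) R) :
  (0 <= W1 mu nu)%E.
Proof.
apply: le_ereal_inf_tmp => _ [la _ <-]; apply: integral_ge0 => z _.
by rewrite lee_fin sqrtr_ge0.
Qed.

(** * The bound in expectation *)

Section Expectation.
Context {R : realType} {disp : measure_display} {Omega : measurableType disp}
  (P : probability Omega R) (d : nat).

(** For nonnegative functions this is measurability of integrals against a
    kernel; a bounded function is shifted to a nonnegative one. *)
Lemma measurable_mean (mu : {RV P >-> pprobability (d.-tuple R) R})
    (F : d.-tuple R -> R) : bounded_measurable F ->
  measurable_fun [set: Omega] (fun w => mean (mu w) F).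
Proof.
move=> bF; have [mF [M FM]] := bF.
have mmu : measurable_fun [set: Omega] (mu : Omega -> pprobability (d.-tuple R) R).
  exact: measurable_funP.
have mI : measurable_fun [set: Omega]
    (fun w => (\int[kprobability mmu w]_x (F x + M)%:E)%E).
  apply: measurable_fun_integral_kernel.
  - by move=> U mU; exact: measurable_kernel.
  - by move=> x; rewrite lee_fin; have := FM x; rewrite ler_norml; lra.
  - by apply/measurable_EFinP; apply: measurable_funD => //; exact: measurable_cst.
have -> : (fun w => mean (mu w) F) =
    (fun w => fine (\int[kprobability mmu w]_x (F x + M)%:E)%E - M).
  apply/funext => w; have bM := @bounded_measurable_cst _ (d.-tuple R) R M.
  have := meanB (mu w) _ _ (bounded_measurableD F _ bF bM) bM.
  rewrite {3}/mean Rintegral_cst // -[X in M * fine X]/(mu w setT).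
  rewrite probability_setT mulr1 => <-.
  by congr mean; apply/funext => x; rewrite addrK.
apply: measurable_funB; last exact: measurable_cst.
exact: measurableT_comp mI.
Qed.

Lemma measurable_char_gap (mu nu : {RV P >-> pprobability (d.-tuple R) R})
    (m : d.-tuple int) :
  measurable_fun [set: Omega] (fun w => char_gap d (mu w) (nu w) m).
Proof.
under eq_fun do rewrite char_gapE.
have mc := bounded_measurable_cos _ (measurable_inner d (pi_lattice R m)).
have ms := bounded_measurable_sin _ (measurable_inner d (pi_lattice R m)).
by apply: measurable_funD; apply: measurable_funX; apply: measurable_funB;
  exact: measurable_mean.
Qed.

Variables (mu nu : {RV P >-> pprobability (d.-tuple R) R}) (delta : R).
Hypothesis d_gt0 : (0 < d)%N.
Hypothesis mu_cube : forall w, mu w (@cube R d) = 1%E.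
Hypothesis nu_cube : forall w, nu w (@cube R d) = 1%E.
Hypothesis gap_le : forall m : d.-tuple int,
  (\int[P]_w (char_gap d (mu w) (nu w) m)%:E <= (delta ^+ 2)%:E)%E.

Definition spectral_sum (T : nat) : R :=
  \sum_(m : {ffun 'I_d -> 'I_T.+1} | m != [ffun=> ord0])
    mode_weight d T m / \sum_i (m i)%:R ^+ 2.

Lemma expected_W1_le (T : nat) (k t : R) : 0 < k -> 0 < t ->
  (\int[P]_w W1 (mu w) (nu w) <= (k + 16 / 5 * Num.sqrt d%:R / T.+2%:R +
    2^-1 * (t * d%:R + t^-1 * (delta ^+ 2 * (spectral_sum T / 8))))%:E)%E.
Proof.
move=> k0 t0.
pose A : R := k + 16 / 5 * Num.sqrt d%:R / T.+2%:R + 2^-1 * (t * d%:R).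
pose I := {ffun 'I_d -> 'I_T.+1}.
pose e (m : I) : R :=
  2^-1 * t^-1 * (mode_weight d T m / (8 * \sum_i (m i)%:R ^+ 2)).
have e0 m : 0 <= e m.
  rewrite /e; apply: mulr_ge0; first by rewrite mulr_ge0 ?invr_ge0 ?(ltW t0).
  apply: divr_ge0; first exact/ltW/mode_weight_gt0.
  by rewrite mulr_ge0 // sumr_ge0 // => i _; rewrite exprn_ge0.
pose c (m : I) : R := if m != [ffun=> ord0] then e m else 0.
have c0 m : 0 <= c m by rewrite /c; case: ifP.
pose S := {ffun 'I_d -> bool}.
have A0 : 0 <= A.
  apply: addr_ge0; last by rewrite mulr_ge0 ?mulr_ge0 ?invr_ge0 ?(ltW t0).
  apply: addr_ge0; first exact: ltW.
  by rewrite divr_ge0 // mulr_ge0 ?sqrtr_ge0 // divr_ge0.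
pose G (u : I * S) w : R :=
  c u.1 * (2 ^- d * char_gap d (mu w) (nu w) (flip_signs d u.1 u.2)).
have G0 u w : 0 <= G u w.
  apply: mulr_ge0; first exact: c0.
  by apply: mulr_ge0; [rewrite invr_ge0 exprn_ge0|exact: char_gap_ge0].
have mG u : measurable_fun [set: Omega] (G u).
  by do 2![apply: measurable_funM; first exact: measurable_cst];
    exact: measurable_char_gap.
apply: (@le_trans _ _ (\int[P]_w (A%:E + \sum_(u : I * S) (G u w)%:E)%E)%E).
  apply: ge0_le_integral_nonmeasurable => w; first exact: W1_ge0.
  apply: (le_trans (W1_le_modes d _ _ T k t d_gt0 k0 t0 (mu_cube w) (nu_cube w))).
  rewrite sumEFin -EFinD lee_fin /A mulrDr !addrA lerD2l.
  rewrite big_mkcond /= !mulr_sumr -(pair_bigA _ (fun m s => G (m, s) w)) /=.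
  apply: ler_sum => m _; rewrite /G /c /=; case: ifP => _; last first.
    by rewrite !mulr0; apply: sumr_ge0 => s _; rewrite mul0r.
  rewrite -mulr_sumr.
  set N := mode_weight d T m; set q := 8 * _.
  have -> : forall u, 2^-1 * (t^-1 * (N * u / q)) = 2^-1 * t^-1 * (N / q) * u.
    by move=> u; ring.
  by apply: ler_wpM2l; [exact: e0|exact: mode_gap_le].
rewrite ge0_integralD //; last 2 first.
- by move=> w _; apply: sume_ge0 => u _; rewrite lee_fin.
- by apply: emeasurable_sum => u; exact/measurable_EFinP.
rewrite integral_cst // ge0_integral_sum //; last 2 first.
- by move=> u; exact/measurable_EFinP.
- by move=> u w _; rewrite lee_fin.
apply: (@le_trans _ _ (A%:E + \sum_(u : I * S) (c u.1 * (2 ^- d * delta ^+ 2))%:E)%E).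
  apply: leeD; first by rewrite -[X in (_ * X)%E]/(P setT) probability_setT mule1.
  apply: lee_sum => u _; rewrite /G.
  under eq_integral do rewrite mulrA EFinM.
  rewrite ge0_integralZl //; last 3 first.
  - by apply/measurable_EFinP; exact: measurable_char_gap.
  - by move=> w _; rewrite lee_fin char_gap_ge0.
  - by rewrite lee_fin mulr_ge0 ?invr_ge0 ?exprn_ge0.
  have -> : (c u.1 * (2 ^- d * delta ^+ 2))%:E =
    ((c u.1 * 2 ^- d)%:E * (delta ^+ 2)%:E)%E by rewrite -EFinM mulrA.
  apply: lee_wpmul2l; last exact: gap_le.
  by rewrite lee_fin mulr_ge0 ?invr_ge0 ?exprn_ge0.
rewrite sumEFin -EFinD lee_fin /A mulrDr addrA lerD2l.
rewrite -(pair_bigA _ (fun m (s : S) => c m * (2 ^- d * delta ^+ 2))) /=.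
under eq_bigr => m _.
  rewrite sumr_const card_ffun card_bool card_ord -[_ *+ _]mulr_natl natrX.
  rewrite (_ : 2 ^+ d * (c m * (2 ^- d * delta ^+ 2)) = c m * delta ^+ 2); last first.
    by field; rewrite expf_neq0.
  over.
rewrite -mulr_suml /c -big_mkcond /= /spectral_sum.
rewrite -mulr_sumr.
have -> : \sum_(m : I | m != [ffun=> ord0]) mode_weight d T m / (8 * \sum_i (m i)%:R ^+ 2) =
   spectral_sum T / 8.
  by rewrite /spectral_sum mulr_suml; apply: eq_bigr => m _; rewrite invfM; ring.
by rewrite le_eqVlt; apply/orP; left; apply/eqP; rewrite /spectral_sum; ring.
Qed.

(** Optimizing the free parameter of the previous bound. *)
Lemma expected_W1_spectral (T : nat) (k B : R) : 0 < k -> 0 < B ->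
  delta ^+ 2 * spectral_sum T <= 8 * B ^+ 2 ->
  (\int[P]_w W1 (mu w) (nu w) <=
    (k + Num.sqrt d%:R * (16 / 5 / T.+2%:R + B))%:E)%E.
Proof.
move=> k0 B0 SB.
have sd0 : 0 < Num.sqrt (d%:R : R) by rewrite sqrtr_gt0 ltr0n.
have t0 : 0 < B / Num.sqrt d%:R by rewrite divr_gt0.
apply: (le_trans (expected_W1_le T k _ k0 t0)); rewrite lee_fin.
move: t0; set s := Num.sqrt d%:R in sd0 *; set t := B / s => t0.
have tB : t^-1 * (delta ^+ 2 * (spectral_sum T / 8)) <= s * B.
  have -> : s * B = t^-1 * B ^+ 2 by rewrite /t; field; rewrite !gt_eqF.
  by rewrite ler_pM2l ?invr_gt0 //; lra.
have tE : t * d%:R = s * B.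
  have -> : (d%:R : R) = s * s by rewrite -expr2 sqr_sqrtr ?ler0n.
  by rewrite /t; field; rewrite gt_eqF.
have -> : 16 / 5 * s / T.+2%:R = s * (16 / 5 / T.+2%:R) by ring.
rewrite tE [s * (_ + _)]mulrDr addrA lerD2l -[X in _ <= X](mulKf (x := 2)) //.
by rewrite ler_pM2l ?invr_gt0 // mulr_natl mulr2n lerD2l.
Qed.

End Expectation.

(** * Sums of inverse squared frequencies *)

Section SpectralSums.
Context {R : realType} (d T : nat).

Local Notation freq := {ffun 'I_d -> 'I_T.+1}.

Definition in_box (k : nat) (m : freq) : bool := [forall i, (m i <= k)%N].

Definition box_sum (k : nat) : R :=
  \sum_(m : freq | (m != [ffun=> ord0]) && in_box k m)
    mode_weight d T m / \sum_i (m i)%:R ^+ 2.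

Lemma box_sum_full : box_sum T = spectral_sum d T.
Proof.
apply: eq_bigl => m.
have -> : in_box T m by apply/forallP => i; rewrite -ltnS.
by rewrite andbT.
Qed.

Lemma box_sum0 : box_sum 0 = 0.
Proof.
rewrite /box_sum big_pred0 // => m; apply/negbTE; rewrite negb_and negbK.
case: (boolP (in_box 0 m)) => [/forallP H|_]; last by rewrite orbT.
by rewrite orbF; apply/eqP/ffunP => i; apply/val_inj; rewrite ffunE /=;
  apply/eqP; rewrite -leqn0.
Qed.

(** The weight of a mode is the number of integer vectors with the same
    absolute values, so a box has weight [(2 * k + 1) ^ d]. *)
Lemma box_weight (k : nat) : (k <= T)%N ->
  \sum_(m : freq | in_box k m) mode_weight d T m = (2 * k%:R + 1) ^+ d :> R.
Proof.
move=> kT; rewrite big_mkcond /=.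
pose F (i : 'I_d) (j : 'I_T.+1) : R := if (j <= k)%N then freq_weight j else 0.
rewrite (eq_bigr (fun m : freq => \prod_i F i (m i))) => [|m _]; last first.
  case: (boolP (in_box k m)) => [/forallP H|/forallPn[i mi]].
    by apply: eq_bigr => i _; rewrite /F H.
  by rewrite (bigD1 i) //= /F (negbTE mi) mul0r.
rewrite -bigA_distr_bigA.
rewrite (eq_bigr (fun=> 2 * k%:R + 1)); first by rewrite prodr_const card_ord.
move=> i _; rewrite /F -big_mkcond /=.
rewrite -(big_mkord (fun j => j <= k)%N (fun j => freq_weight j)).
rewrite (big_cat_nat (n := k.+1)) //= [X in _ + X]big1_seq ?addr0; last first.
  by move=> j /andP[jk]; rewrite mem_index_iota ltnNge jk.
rewrite big_nat_cond (eq_bigl (fun j => 0 <= j < k.+1)%N) => [|j]; last first.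
  by rewrite -andbA andbb.
rewrite -big_nat big_nat_recl // /freq_weight /= addrC; congr (_ + _).
by rewrite sumr_const_nat subn0 mulr_natr.
Qed.

(** On the shell of maximum norm [k + 1] the squared Euclidean norm is at least
    [(k + 1) ^+ 2]. *)
Lemma box_sum_step (k : nat) : (k < T)%N ->
  box_sum k.+1 <= box_sum k +
    ((2 * k.+1%:R + 1) ^+ d - (2 * k%:R + 1) ^+ d) / k.+1%:R ^+ 2.
Proof.
move=> kT; rewrite -!box_weight ?(ltnW kT) //.
have sub m : in_box k m -> in_box k.+1 m.
  by move=> /forallP H; apply/forallP => i; exact: leqW.
have m0 (m : freq) : ~~ in_box k m -> m != [ffun=> ord0].
  by apply: contraNneq => ->; apply/forallP => i; rewrite ffunE.
rewrite /box_sum (bigID (in_box k)) /=.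
rewrite [X in _ <= _ + (X - _) / _](bigID (in_box k)) /=.
rewrite (eq_bigl (fun m => (m != [ffun=> ord0]) && in_box k m)) => [|m]; last first.
  by case: (boolP (in_box k m)) => [/sub ->|_]; rewrite ?andbF ?andbT.
rewrite [X in _ <= _ + (X + _ - _) / _](eq_bigl (in_box k)) => [|m]; last first.
  by case: (boolP (in_box k m)) => [/sub ->|_]; rewrite ?andbF.
rewrite lerD2l addrAC subrr add0r mulr_suml.
rewrite (eq_bigl (fun m => in_box k.+1 m && ~~ in_box k m)) => [|m]; last first.
  by case: (boolP (in_box k m)) => [_|/m0 ->]; rewrite ?andbF ?andbT.
apply: ler_sum => m /andP[_]; rewrite /in_box negb_forall => /existsP[i mi].
rewrite ler_wpM2l ?(ltW (mode_weight_gt0 _ _ _)) //.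
have k2 : 0 < (k.+1%:R ^+ 2 : R) by rewrite exprn_gt0 // ltr0n.
have km : (k.+1%:R ^+ 2 : R) <= \sum_i (m i)%:R ^+ 2.
  rewrite (bigD1 i) //= -[X in X <= _]addr0 lerD //.
    by rewrite ler_pXn2r ?nnegrE ?ler0n // ler_nat ltnNge.
  by apply: sumr_ge0 => j _; rewrite exprn_ge0.
by rewrite lef_pV2 ?posrE // (lt_le_trans k2).
Qed.

Lemma box_sum_dim1 (k : nat) : d = 1%N -> (k < T)%N ->
  box_sum k.+1 <= 4 - 2 / k.+1%:R.
Proof.
move=> d1; elim: k => [|k IH] kT; have H := box_sum_step _ kT.
  apply: (le_trans H); rewrite box_sum0 d1 !expr1 add0r mulr0 add0r mulr1 expr1n.
  by rewrite divr1; lra.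
apply: (le_trans H); rewrite d1 !expr1.
have {IH}H := IH (ltnW kT).
have k1 : 0 < (k.+1%:R : R) by rewrite ltr0n.
rewrite -[k.+2%:R]natr1; move: (k.+1%:R : R) k1 H => x x0 H.
clear d1 kT; have -> : 2 * (x + 1) + 1 - (2 * x + 1) = 2 by ring.
have E : 4 - 2 / (x + 1) - (4 - 2 / x + 2 / (x + 1) ^+ 2) =
    2 / (x * (x + 1) ^+ 2) by field; lra.
have : 0 <= 2 / (x * (x + 1) ^+ 2).
  by rewrite divr_ge0 // mulr_ge0 ?ltW // exprn_gt0 // ltr_pwDl.
lra.
Qed.

Lemma box_sum_dim2 (k : nat) : d = 2%N -> (k < T)%N ->
  box_sum k.+1 <= 8 * (1 + ln k.+1%:R).
Proof.
move=> d2; elim: k => [|k IH] kT; have H := box_sum_step _ kT.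
  apply: (le_trans H); rewrite box_sum0 d2 ln1 add0r mulr0 add0r mulr1 !expr1n.
  by rewrite divr1; lra.
apply: (le_trans H); rewrite d2.
have {IH}H := IH (ltnW kT).
have k1 : 0 < (k.+1%:R : R) by rewrite ltr0n.
rewrite -[k.+2%:R]natr1; move: (k.+1%:R : R) k1 H => x x0 H.
clear d2 kT; have -> : ((2 * (x + 1) + 1) ^+ 2 - (2 * x + 1) ^+ 2) / (x + 1) ^+ 2 = 8 / (x + 1).
  by field; lra.
(* 1 / (x + 1) <= ln ((x + 1) / x), from ln (1 - u) <= - u *)
have L : (x + 1)^-1 <= ln (x + 1) - ln x.
  have u1 : -1 < - (x + 1)^-1.
    by rewrite ltrN2 invf_lt1 ?ltr_pwDl // ltrDr.
  have := le_ln1Dx u1.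
  have -> : 1 - (x + 1)^-1 = x / (x + 1) by field; lra.
  by rewrite ln_div ?posrE ?ltr_pwDl //; lra.
lra.
Qed.

(** With [a = (2 * k + 1) ^+ d] and [b = (2 * k + 3) ^+ d], the ratio [b / a] is
    at least [((2 * k + 3) / (2 * k + 1)) ^+ 3]; this is what the induction step
    needs, with a constant such as 6 that is large enough from [k = 1] on. *)
Lemma box_sum_dim3 (k : nat) : (3 <= d)%N -> (k < T)%N ->
  box_sum k.+1 <= 6 * (2 * k.+1%:R + 1) ^+ d / k.+1%:R ^+ 2.
Proof.
move=> d3; elim: k => [|k IH] kT; have H := box_sum_step _ kT.
  apply: (le_trans H); rewrite box_sum0 add0r mulr0 add0r !expr1n !divr1.
  have : 0 <= (2 * 1 + 1) ^+ d :> R by rewrite exprn_ge0 // addr_ge0 // mulr_ge0.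
  lra.
apply: (le_trans H).
have {IH}H := IH (ltnW kT).
have k1 : 1 <= (k.+1%:R : R) by rewrite ler1n.
rewrite -[k.+2%:R]natr1; move: (k.+1%:R : R) k1 H => x x1 H.
have x0 : 0 < x by lra.
set a := (2 * x + 1) ^+ d; set b := (2 * (x + 1) + 1) ^+ d.
have a0 : 0 < a by rewrite exprn_gt0 //; lra.
have ab : a * (2 * (x + 1) + 1) ^+ 3 <= b * (2 * x + 1) ^+ 3.
  have aE : a = (2 * x + 1) ^+ (d - 3) * (2 * x + 1) ^+ 3.
    by rewrite -exprD subnK.
  have bE : b = (2 * (x + 1) + 1) ^+ (d - 3) * (2 * (x + 1) + 1) ^+ 3.
    by rewrite -exprD subnK.
  rewrite aE bE mulrAC ler_pM2r ?exprn_gt0 //; last by lra.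
  rewrite ler_pM2r ?exprn_gt0 //; last by lra.
  by rewrite lerXn2r ?nnegrE //; lra.
have poly : (2 * x + 1) ^+ 3 * (6 * (x + 1) ^+ 2 - x ^+ 2) <=
    5 * (2 * (x + 1) + 1) ^+ 3 * x ^+ 2.
  have -> : x = 1 + (x - 1) by ring.
  have : 0 <= x - 1 by lra.
  move: (x - 1) => y y0; rewrite -subr_ge0.
  set D := (X in 0 <= X).
  have -> : D = 4 + 164 * y + 274 * y ^+ 2 + 144 * y ^+ 3 + 24 * y ^+ 4.
    by rewrite /D; ring.
  have := exprn_ge0 2 y0; have := exprn_ge0 3 y0; have := exprn_ge0 4 y0.
  by clear -y0; lra.
have c0 : 0 < (2 * x + 1) ^+ 3 by rewrite exprn_gt0 //; lra.
have main : a * (6 * (x + 1) ^+ 2 - x ^+ 2) <= 5 * b * x ^+ 2.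
  rewrite -(ler_pM2r c0).
  have H1 := ler_wpM2l (ltW a0) poly.
  have x2 : 0 <= 5 * x ^+ 2 by rewrite mulr_ge0 // sqr_ge0.
  have H2 := ler_wpM2r x2 ab.
  have E1 : a * (6 * (x + 1) ^+ 2 - x ^+ 2) * (2 * x + 1) ^+ 3 =
    a * ((2 * x + 1) ^+ 3 * (6 * (x + 1) ^+ 2 - x ^+ 2)) by ring.
  have E2 : a * (5 * (2 * (x + 1) + 1) ^+ 3 * x ^+ 2) =
    a * (2 * (x + 1) + 1) ^+ 3 * (5 * x ^+ 2) by ring.
  have E3 : 5 * b * x ^+ 2 * (2 * x + 1) ^+ 3 =
    b * (2 * x + 1) ^+ 3 * (5 * x ^+ 2) by ring.
  by rewrite E1 E3; apply: (le_trans H1); rewrite E2.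
apply: (le_trans (lerD H (lexx _))); rewrite -/a -/b -subr_ge0.
have -> : 6 * b / (x + 1) ^+ 2 - (6 * a / x ^+ 2 + (b - a) / (x + 1) ^+ 2) =
  (5 * b * x ^+ 2 - a * (6 * (x + 1) ^+ 2 - x ^+ 2)) / (x ^+ 2 * (x + 1) ^+ 2).
  by field; lra.
by rewrite divr_ge0 ?subr_ge0 // mulr_ge0 ?sqr_ge0.
Qed.

End SpectralSums.

Lemma exists_inv_le {R : realType} (e : R) : 0 < e -> exists n : nat, n.+2%:R^-1 <= e.
Proof.
move=> e0; exists (Num.truncn e^-1).
rewrite invf_ple ?posrE ?ltr0n //; apply/ltW.
by apply: (lt_trans (Num.Theory.truncnS_gt _)); rewrite ltr_nat.
Qed.

(** * Choice of the degree in each dimension *)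

Section Bounds.
Context {R : realType} {disp : measure_display} {Omega : measurableType disp}
  (P : probability Omega R) (d : nat)
  (mu nu : {RV P >-> pprobability (d.-tuple R) R}) (delta : R).
Hypothesis mu_cube : forall w, mu w (@cube R d) = 1%E.
Hypothesis nu_cube : forall w, nu w (@cube R d) = 1%E.
Hypothesis delta_ge0 : 0 <= delta.
Hypothesis delta_le2 : delta <= 2.
Hypothesis gap_le : forall m : d.-tuple int,
  (\int[P]_w (char_gap d (mu w) (nu w) m)%:E <= (delta ^+ 2)%:E)%E.

Let EW1 := (\int[P]_w W1 (mu w) (nu w))%E.

Lemma expected_W1_zero : (0 < d)%N -> delta = 0 -> (EW1 <= 0)%E.
Proof.
move=> d0 delta0; apply/lee_addgt0Pr => e e0; rewrite add0e.
have sd0 : 0 < Num.sqrt (d%:R : R) by rewrite sqrtr_gt0 ltr0n.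
pose r := e / (2 * Num.sqrt d%:R * (16 / 5 + 1)).
have r0 : 0 < r by rewrite divr_gt0 // mulr_gt0 ?mulr_gt0 //; lra.
have [T Tr] := exists_inv_le r r0.
have e2 : 0 < e / 2 by rewrite divr_gt0.
have SB : delta ^+ 2 * spectral_sum d T <= 8 * r ^+ 2.
  by rewrite delta0 expr0n mul0r mulr_ge0 // sqr_ge0.
apply: le_trans (expected_W1_spectral P d mu nu delta d0 mu_cube nu_cube gap_le
  T (e / 2) r e2 r0 SB) _.
rewrite lee_fin.
have H : Num.sqrt d%:R * (16 / 5 / T.+2%:R + r) <= e / 2.
  have -> : e / 2 = Num.sqrt d%:R * (16 / 5 * r + r).
    by rewrite /r; field; rewrite gt_eqF.
  by rewrite ler_pM2l // lerD2r ler_pM2l //; lra.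
by apply: (le_trans (lerD (lexx _) H)); lra.
Qed.

(** The spectral sum is bounded, so that a large degree makes the smoothing
    error small against [delta]; the condition on the remaining term is
    [4 <= 8 * (3 / 4) ^+ 2], which leaves room for it. *)
Lemma expected_W1_dim1 : d = 1%N -> (EW1 <= delta%:E)%E.
Proof.
move=> d1; have [delta0|delta_neq0] := eqVneq delta 0.
  by rewrite delta0; apply: expected_W1_zero => //; rewrite d1.
have delta_gt0 : 0 < delta by rewrite lt0r delta_neq0.
have d0 : (0 < d)%N by rewrite d1.
have r0 : 0 < delta / 64 by rewrite divr_gt0.
have [T Tr] := exists_inv_le _ r0.
have S4 : (spectral_sum d T : R) <= 4.
  rewrite -box_sum_full; case: T Tr => [|T] _; first by rewrite box_sum0.
  apply: (le_trans (box_sum_dim1 _ _ _ d1 (ltnSn T))).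
  by rewrite lerBlDr lerDl divr_ge0 // ler0n.
have B0 : 0 < 3 / 4 * delta by rewrite mulr_gt0.
have SB : delta ^+ 2 * spectral_sum d T <= 8 * (3 / 4 * delta) ^+ 2.
  have := ler_wpM2l (sqr_ge0 delta) S4.
  by have := sqr_ge0 delta; rewrite exprMn; lra.
apply: le_trans (expected_W1_spectral P d mu nu delta d0 mu_cube nu_cube gap_le
  T (delta / 64) _ r0 B0 SB) _.
rewrite lee_fin [X in Num.sqrt X%:R]d1 sqrtr1 mul1r.
by move: (T.+2%:R^-1) Tr => u Tr; lra.
Qed.

(** The degree [2 / delta] makes the smoothing error of order [delta], while the
    logarithmic growth of the spectral sum gives the logarithm. *)
Lemma expected_W1_dim2 : d = 2%N ->
  (EW1 <= (5 * delta * Num.sqrt (1 + ln (4 / delta ^+ 2)))%:E)%E.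
Proof.
move=> d2; have [delta0|delta_neq0] := eqVneq delta 0.
  rewrite delta0 mulr0 mul0r; apply: expected_W1_zero => //; by rewrite d2.
have delta_gt0 : 0 < delta by rewrite lt0r delta_neq0.
have d0 : (0 < d)%N by rewrite d2.
pose x := 2 / delta.
have x1 : 1 <= x by rewrite /x ler_pdivlMr // mul1r.
have xE : 4 / delta ^+ 2 = x ^+ 2 by rewrite /x; field; rewrite gt_eqF.
set L := Num.sqrt _.
have lnx : 0 <= ln x by exact: ln_ge0.
have lnE : ln (4 / delta ^+ 2) = 2 * ln x.
  by rewrite xE lnXn ?(lt_le_trans _ x1) // mulr_natl.
have L1 : 1 <= L.
  by rewrite -sqrtr1 ler_wsqrtr // lerDl lnE mulr_ge0.
have L2 : L ^+ 2 = 1 + 2 * ln x.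
  by rewrite sqr_sqrtr lnE // addr_ge0 // mulr_ge0.
pose T := Num.truncn x.
have T0 : (0 < T)%N by rewrite Num.Theory.truncn_gt0.
have x0 : 0 <= x by exact: le_trans x1.
have Tx : (T%:R : R) <= x by rewrite Num.Theory.truncn_le.
have xT : x < T.+1%:R by exact: Num.Theory.truncnS_gt.
have S8 : (spectral_sum d T : R) <= 8 * L ^+ 2.
  rewrite -box_sum_full; move: T0 Tx; case: (T) => [//|t] _ tx.
  apply: (le_trans (box_sum_dim2 _ _ _ d2 (ltnSn t))).
  rewrite L2 ler_pM2l // lerD2l (@le_trans _ _ (ln x)) //; last by lra.
  by rewrite ler_ln ?posrE ?ltr0n // (lt_le_trans _ x1).
have B0 : 0 < delta * L by rewrite mulr_gt0 // (lt_le_trans _ L1).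
have SB : delta ^+ 2 * spectral_sum d T <= 8 * (delta * L) ^+ 2.
  by rewrite exprMn mulrCA; apply: ler_wpM2l; rewrite ?sqr_ge0.
apply: le_trans (expected_W1_spectral P d mu nu delta d0 mu_cube nu_cube gap_le
  T delta _ delta_gt0 B0 SB) _.
rewrite lee_fin [X in Num.sqrt X%:R]d2.
have s2 : Num.sqrt 2 <= 3 / 2 :> R.
  rewrite -[X in _ <= X]ger0_norm ?divr_ge0 // -sqrtr_sqr ler_wsqrtr //; lra.
have MT : 16 / 5 / T.+2%:R <= 8 / 5 * delta.
  rewrite ler_pdivrMr ?ltr0n //.
  have : x * delta = 2 by rewrite /x divfK.
  have : x * delta <= T.+2%:R * delta.
    by rewrite ler_pM2r // (le_trans (ltW xT)) // ler_nat.
  lra.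
have dL : delta <= delta * L by rewrite ler_peMr.
have H : Num.sqrt 2 * (16 / 5 / T.+2%:R + delta * L) <=
    3 / 2 * (8 / 5 * delta + delta * L).
  apply: ler_pM => //.
    by rewrite addr_ge0 ?(ltW B0) // divr_ge0 ?ler0n // divr_ge0.
  by rewrite lerD2r.
apply: (le_trans (lerD (lexx _) H)); rewrite -[5 * delta * L]mulrA.
by move: (delta * L) dL => z dL; lra.
Qed.

(** With [y = delta `^ (2 / d)], the degree is taken such that the frequency box
    of side [2 * T + 1] has at most [delta ^- 2] points: then both errors are of
    order [1 / T], that is of order [y]. *)
Lemma expected_W1_dim3 : (3 <= d)%N ->
  (EW1 <= (10 * Num.sqrt d%:R * delta `^ (2 / d%:R))%:E)%E.
Proof.
move=> d3; have d0 : (0 < d)%N by exact: leq_trans d3.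
have sd0 : 0 < Num.sqrt (d%:R : R) by rewrite sqrtr_gt0 ltr0n.
have [delta0|delta_neq0] := eqVneq delta 0.
  apply: (le_trans (expected_W1_zero d0 delta0)).
  by rewrite lee_fin mulr_ge0 ?powR_ge0 // mulr_ge0 // sqrtr_ge0.
have delta_gt0 : 0 < delta by rewrite lt0r delta_neq0.
set y := delta `^ _.
have y0 : 0 < y by exact: powR_gt0.
have yd : y ^+ d = delta ^+ 2.
  rewrite -powR_mulrn ?(ltW y0) // /y -powRrM divfK ?pnatr_eq0 -?lt0n //.
  by rewrite powR_mulrn.
have [y3|y3] := ltP 3^-1 y.
  (* only the constant mode: the smoothing error alone is below the bound *)
  have k0 : 0 < Num.sqrt d%:R * y by rewrite mulr_gt0.
  have SB : delta ^+ 2 * spectral_sum d 0 <= 8 * y ^+ 2.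
    by rewrite -box_sum_full box_sum0 mulr0 mulr_ge0 // sqr_ge0.
  apply: le_trans (expected_W1_spectral P d mu nu delta d0 mu_cube nu_cube gap_le
    0 _ _ k0 y0 SB) _.
  rewrite lee_fin -mulrDr [10 * _ * y]mulrAC [10 * y * _]mulrC ler_pM2l //; lra.
pose x := (y^-1 - 1) / 2.
have yx : y^-1 = 2 * x + 1 by rewrite /x mulrC divfK // subrK.
have x1 : 1 <= x.
  have : 3 <= y^-1 by rewrite -[3]invrK lef_pV2 ?posrE // invr_gt0.
  by rewrite /x; lra.
pose T := Num.truncn x.
have T0 : (0 < T)%N by rewrite Num.Theory.truncn_gt0.
have x0 : 0 <= x by exact: le_trans x1.
have Tx : (T%:R : R) <= x by rewrite Num.Theory.truncn_le.
have xT : x < T.+1%:R by exact: Num.Theory.truncnS_gt.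
have TR : 1 <= (T%:R : R) by rewrite ler1n.
have B0 : 0 < 9 / 10 / T%:R :> R by rewrite divr_gt0 // (lt_le_trans _ TR).
have Td : delta ^+ 2 * (2 * T%:R + 1) ^+ d <= 1.
  rewrite -yd -exprMn; apply: exprn_ile1.
    by rewrite mulr_ge0 ?(ltW y0) // addr_ge0 // mulr_ge0 // ler0n.
  by rewrite mulrC -ler_pdivlMr // mul1r yx; lra.
have T2 : 0 < (T%:R ^+ 2 : R) by rewrite exprn_gt0 // ltr0n.
have S6 : (spectral_sum d T : R) <= 6 * (2 * T%:R + 1) ^+ d / T%:R ^+ 2.
  rewrite -box_sum_full; case: (T) T0 => [//|t] _.
  exact: box_sum_dim3.
(* 6 / T ^+ 2 <= 8 * (9 / 10 / T) ^+ 2, as 8 * 81 / 100 = 6.48 *)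
have SB : delta ^+ 2 * spectral_sum d T <= 8 * (9 / 10 / T%:R) ^+ 2.
  apply: (le_trans (ler_wpM2l (sqr_ge0 delta) S6)).
  have -> : delta ^+ 2 * (6 * (2 * T%:R + 1) ^+ d / T%:R ^+ 2) =
    6 * (delta ^+ 2 * (2 * T%:R + 1) ^+ d) / T%:R ^+ 2 by ring.
  have -> : 8 * (9 / 10 / T%:R) ^+ 2 = 8 * (9 / 10) ^+ 2 / T%:R ^+ 2 :> R.
    by rewrite expr_div_n mulrA.
  by rewrite ler_pM2r ?invr_gt0 //; lra.
have lt_y : 10 / (2 * T%:R + 3) < 10 * y.
  have T3 : 0 < 2 * T%:R + 3 :> R by lra.
  by rewrite ltr_pM2l // invf_plt ?posrE // yx; move: xT; rewrite -natr1; lra.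
have k0 : 0 < Num.sqrt d%:R * (10 * y - 10 / (2 * T%:R + 3)).
  by rewrite mulr_gt0 // subr_gt0.
apply: le_trans (expected_W1_spectral P d mu nu delta d0 mu_cube nu_cube gap_le
  T _ _ k0 B0 SB) _.
rewrite lee_fin -mulrDr [10 * _ * y]mulrAC [10 * y * _]mulrC ler_pM2l //.
have main : 16 / 5 / T.+2%:R + 9 / 10 / T%:R <= 10 / (2 * T%:R + 3) :> R.
  rewrite -[T.+2%:R]natr1 -[T.+1%:R]natr1; move: (T%:R : R) TR => z z1.
  rewrite -subr_ge0.
  have -> : 10 / (2 * z + 3) - (16 / 5 / (z + 1 + 1) + 9 / 10 / z) =
    (18 * z ^+ 2 + 41 * z - 54) / (10 * (2 * z + 3) * (z + 2) * z).
    by field; rewrite !gt_eqF //; lra.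
  rewrite divr_ge0 //.
    by have := exprn_ege1 2 z1; lra.
  by rewrite !mulr_ge0 //; lra.
by apply: (le_trans (lerD (lexx _) main)); rewrite subrK.
Qed.

End Bounds.

Theorem proposition6 (R : realType) (disp : measure_display)
  (Omega : measurableType disp) (P : probability Omega R)
  (d : nat) (d_ge1 : (1 <= d)%N)
  (mu nu : {RV P >-> pprobability (d.-tuple R) R})
  (mu_cube : forall w : Omega, mu w (@cube R d) = 1%E)
  (nu_cube : forall w : Omega, nu w (@cube R d) = 1%E)
  (delta : R) (delta_ge0 : 0 <= delta) (delta_le2 : delta <= 2)
  (char_close : forall m : d.-tuple int,
    ('E_P[fun w : Omega =>
       (ComplexField.Normc.normc
          (char_fun (mu w) (pi_lattice R m) - char_fun (nu w) (pi_lattice R m))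
        ^+ 2)%R]
     <= (delta ^+ 2)%:E)%E) :
  (\int[P]_w W1 (mu w) (nu w) <= (W1_bound d delta)%:E)%E.
Proof.
have gap_le m : (\int[P]_w (char_gap d (mu w) (nu w) m)%:E <= (delta ^+ 2)%:E)%E.
  by have := char_close m; rewrite unlock.
rewrite /W1_bound; have [d1|dN1] := eqVneq d 1%N; first exact: expected_W1_dim1.
have [d2|dN2] := eqVneq d 2%N; first exact: expected_W1_dim2.
by apply: expected_W1_dim3 => //; move: d_ge1 dN1 dN2; case: (d) => [|[|[]]].
Qed.
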